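(* Let $\mathcal{P}$ be a finite-support distribution (as defined in the context) whose induced linear program $\mathrm{LP}^{\mathrm{induced}}(\bm B,\bm\mu)$ is non-degenerate, and let $\bm\pi_{\mathrm{finite}}$ be the online policy (Algorithm 2) described in the context. Then $$\mathrm{Regret}_{\mathcal{P}}(\bm{\pi}_{\mathrm{finite}})=\mathcal{O}(\log T),$$ with a constant independent of $T$.
   Context: Online linear programming with replenishment. There are $m$ resources and a horizon $T$. Tuples $(r_t,\bm{a}_t,\bm{b}_t)\in\mathbb{R}\times\mathbb{R}^m\times\mathbb{R}^m_{\geq 0}$, $t=1,\dots,T$, are drawn i.i.d. from a distribution $\mathcal{P}$. Inventory starts at $0$. In period $t$ each resource $j$ is first replenished by $b_{jt}$; then the order $(r_t,\bm{a}_t)$ is revealed and the decision maker chooses $x_t\in\{0,1\}$ (possibly at random) based only on $(r_k,\bm{a}_k,\bm{b}_k,x_k)_{k<t}$ and $(r_t,\bm{a}_t,\bm{b}_t)$. A policy is feasible if for every realization $\sum_{k\le t}a_{jk}x_k\le\sum_{k\le t}b_{jk}$ for all $j,t$. $R^*$ is the maximum of $\sum_t r_tx_t$ over $\bm x\in\{0,1\}^T$ subject to these prefix constraints, and $\mathrm{Regret}_{\mathcal{P}}(\bm{\pi})=\mathbb{E}[R^*-\sum_t r_tx_t]$. Finite-support distribution: there are $n$ pairs $(R_i,\bm A_i)\in\mathbb{R}\times\mathbb{R}^m$, $i\in[n]$, with $\mu_i:=\Pr((r,\bm a)=(R_i,\bm A_i))\ge\underline\mu>0$ and $\sum_i\mu_i=1$;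 and constants $\underline b,\bar b>0$ with $B_j:=\mathbb{E}[b_j]>\underline b$ and $\Pr(b_j<\bar b)=1$ for all $j$. The type of the period-$t$ order is $\theta_t\in[n]$ with $(r_t,\bm a_t)=(R_{\theta_t},\bm A_{\theta_t})$, and it is observed. Write $\bm B=(B_j)_j$, $\bm\mu=(\mu_i)_i$. Induced LP $\mathrm{LP}^{\mathrm{induced}}(\bm B',\bm\mu')$: maximize $\sum_{i}R_iX_i$ subject to $\sum_i A_{ji}X_i+S_j=B'_j$ ($j\in[m]$), $X_i+V_i=\mu'_i$ ($i\in[n]$), $X_i,V_i,S_j\ge0$. It is non-degenerate if it has a unique optimal solution and exactly $m+n$ of the variables $X_i,V_i,S_j$ are strictly positive in it; its optimal basis is then the set of (labels of) strictly positive variables. Algorithm 2 takes as input the support $\{(R_i,\bm A_i)\}$, $\underline\mu,\underline b,\bar b$, and a constant $L>0$ such that for every $\widehat{\bm B},\widehat{\bm\mu}$ with $\max_j|\widehat B_j-B_j|\le L$ and $\max_i|\widehat\mu_i-\mu_i|\le L$, $\mathrm{LP}^{\mathrm{induced}}(\widehat{\bm B},\widehat{\bm\mu})$ has a unique optimal solution with the same optimal basis as $\mathrm{LP}^{\mathrm{induced}}(\bm B,\bm\mu)$. Set $C=2\left(1+\frac{8+8\bar b}{\min(L,\underline b,\underline\mu)}\right)^2$, $\kappa=\lceil C\ln T\rceil$, $W=\lceil 4n\max_{i,j}|A_{ji}|/\underline b\rceil$; initialize $\Phi_{i,1}=0$, $\ell_{j,1}=0$. For $t=1,\dots,T$: observe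 $(r_t,\bm a_t,\bm b_t)$ and $\theta_t$; set $\Phi_{i,t+1}=\Phi_{i,t}$ for all $i$. If $t\le W\kappa$, set $x_t=0$. Otherwise, with $z'=\lceil t/\kappa\rceil$: if $\theta_t\in\widehat{\mathcal I}^*_{z'}$ set $x_t=\mathbb{I}(\forall j,\ \ell_{j,t}\ge a_{jt})$; else set $x_t=\mathbb{I}(\Phi_{\theta_t,t}\ge1)\mathbb{I}(\forall j,\ \ell_{j,t}\ge a_{jt})$ and $\Phi_{\theta_t,t+1}\leftarrow\Phi_{\theta_t,t+1}-x_t$. If $t\ge W\kappa$ and $z=t/\kappa+1$ is an integer: compute $\widehat{\bm B}_z=(\sum_{\tau=t-\kappa+1}^t b_{j\tau})_j$ and $\widehat{\bm\mu}_z=(\sum_{\tau=t-\kappa+1}^t\mathbb{I}(\theta_\tau=i))_i$, find an optimal solution $\{X^*_{i,z},V^*_{i,z}\},\{S^*_{j,z}\}$ of $\mathrm{LP}^{\mathrm{induced}}(\widehat{\bm B}_z,\widehat{\bm\mu}_z)$, update $\Phi_{i,t+1}\leftarrow\Phi_{i,t+1}+X^*_{i,z}$ for all $i$ and set $\widehat{\mathcal I}^*_z=\{i:V^*_{i,z}=0\}$. Finally set $\ell_{j,t+1}=\ell_{j,t}+b_{jt}-a_{jt}x_t$. *)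

(* Defs.v *)
From HB Require Import structures.
From mathcomp Require Import all_boot all_order all_algebra.
From mathcomp Require Import all_classical all_reals.
From mathcomp Require Import ereal exp measure lebesgue_measure lebesgue_integral probability.

Set Implicit Arguments.
Unset Strict Implicit.
Unset Printing Implicit Defensive.

Import Order.TTheory GRing.Theory Num.Theory.
Local Open Scope ring_scope.

Section Defs.
Context {R : realType} {n m : nat}.

Definition lpsol := (('I_n -> R) * ('I_n -> R) * ('I_m -> R))%type.

Definition lp_feasible (A : 'I_m -> 'I_n -> R) (B' : 'I_m -> R) (mu' : 'I_n -> R)
  (s : lpsol) : Prop :=
  let: (X, V, Sv) := s in
  [/\ forall j, \sum_i A j i * X i + Sv j = B' j,
      forall i, X i + V i = mu' i,
      forall i, 0 <= X i,
      forall i, 0 <= V i &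
      forall j, 0 <= Sv j].

Definition lp_obj (Rv : 'I_n -> R) (s : lpsol) : R := \sum_i Rv i * s.1.1 i.

Definition lp_optimal Rv A B' mu' (s : lpsol) : Prop :=
  lp_feasible A B' mu' s /\
  forall s', lp_feasible A B' mu' s' -> lp_obj Rv s' <= lp_obj Rv s.

Definition lpsol_eq (s s' : lpsol) : Prop :=
  [/\ forall i, s.1.1 i = s'.1.1 i, forall i, s.1.2 i = s'.1.2 i &
      forall j, s.2 j = s'.2 j].

Definition lp_unique_optimal Rv A B' mu' (s : lpsol) : Prop :=
  lp_optimal Rv A B' mu' s /\ forall s', lp_optimal Rv A B' mu' s' -> lpsol_eq s' s.

Definition lp_basis (s : lpsol) : {set 'I_n} * {set 'I_n} * {set 'I_m} :=
  ([set i | 0 < s.1.1 i], [set i | 0 < s.1.2 i], [set j | 0 < s.2 j]).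

Definition lp_nondegenerate Rv A B' mu' : Prop :=
  exists s, lp_unique_optimal Rv A B' mu' s /\
    (#|(lp_basis s).1.1| + #|(lp_basis s).1.2| + #|(lp_basis s).2| = m + n)%N.

Definition same_opt_basis Rv A B1 mu1 B2 mu2 : Prop :=
  exists s1 s2, [/\ lp_unique_optimal Rv A B1 mu1 s1,
                    lp_unique_optimal Rv A B2 mu2 s2 &
                    lp_basis s2 = lp_basis s1].

(* "find an optimal solution": an arbitrary rule returning an optimal solution
   (one always exists when B', mu' >= 0: the LP is feasible and bounded). *)
Definition lp_selector Rv A (sel : ('I_m -> R) -> ('I_n -> R) -> lpsol) : Prop :=
  forall B' mu', (forall j, 0 <= B' j) -> (forall i, 0 <= mu' i) ->
    lp_optimal Rv A B' mu' (sel B' mu').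

Definition alg_C (mulow blow bbar L : R) : R :=
  2 * (1 + (8 + 8 * bbar) / Num.min L (Num.min blow mulow)) ^+ 2.

Definition alg_kappa (mulow blow bbar L : R) (T : nat) : nat :=
  `|Num.ceil (alg_C mulow blow bbar L * ln (T%:R))|%N.

Definition maxabsA (A : 'I_m -> 'I_n -> R) : R :=
  \big[Num.max/0]_(j : 'I_m) \big[Num.max/0]_(i : 'I_n) `|A j i|.

Definition alg_W (A : 'I_m -> 'I_n -> R) (blow : R) : nat :=
  `|Num.ceil (4 * n%:R * maxabsA A / blow)|%N.

Definition algstate := (('I_n -> R) * ('I_m -> R) * {set 'I_n})%type.

Section Run.
Variables (Rv : 'I_n -> R) (A : 'I_m -> 'I_n -> R)
  (sel : ('I_m -> R) -> ('I_n -> R) -> lpsol) (kappa W : nat)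
  (th : nat -> 'I_n) (bb : nat -> 'I_m -> R).
(* th t = theta_t and bb t = b_t, for periods t = 1, ..., T *)

Definition alg_decide (t : nat) (st : algstate) : bool :=
  let: (Phi, ell, Ih) := st in
  if (t <= W * kappa)%N then false
  else
    let ok := [forall j, A j (th t) <= ell j] in
    if th t \in Ih then ok else (1 <= Phi (th t)) && ok.

Definition alg_Bhat (t : nat) : 'I_m -> R :=
  fun j => \sum_(t.+1 - kappa <= tau < t.+1) bb tau j.

Definition alg_muhat (t : nat) : 'I_n -> R :=
  fun i => \sum_(t.+1 - kappa <= tau < t.+1) ((th tau == i)%:R : R).

Definition alg_next (t : nat) (st : algstate) : algstate :=
  let: (Phi, ell, Ih) := st in
  let x := alg_decide t st in
  let Phi1 := fun i => Phi i -
      (if [&& i == th t, th t \notin Ih & x] then 1 else 0) in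
  let solve := ((W * kappa <= t)%N && (kappa %| t)%N) in
  let s := sel (alg_Bhat t) (alg_muhat t) in
  let Phi2 := if solve then fun i => Phi1 i + s.1.1 i else Phi1 in
  let I2 := if solve then [set i | s.1.2 i == 0] else Ih in
  let ell2 := fun j => ell j + bb t j - A j (th t) * (x%:R) in
  (Phi2, ell2, I2).

(* alg_state k = state at the beginning of period k.+1 *)
Fixpoint alg_state (k : nat) : algstate :=
  match k with
  | 0 => (fun _ => 0, fun _ => 0, finset.set0)
  | k'.+1 => alg_next k'.+1 (alg_state k')
  end.

Definition alg_x (t : nat) : bool := alg_decide t (alg_state t.-1).

Definition alg_reward (T : nat) : R :=
  \sum_(1 <= t < T.+1) Rv (th t) * (alg_x t)%:R.

(* offline optimum R^* (x = 0 is always feasible, with value 0) *)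
Definition offline_feasible (T : nat) (x : {ffun 'I_T -> bool}) : bool :=
  [forall j : 'I_m, forall k : 'I_T,
     \sum_(l : 'I_T | (l <= k)%N) A j (th l.+1) * (x l)%:R
       <= \sum_(l : 'I_T | (l <= k)%N) bb l.+1 j].

Definition offline_opt (T : nat) : R :=
  \big[Num.max/0]_(x : {ffun 'I_T -> bool} | offline_feasible x)
     \sum_(l : 'I_T) Rv (th l.+1) * (x l)%:R.

End Run.

Section Prob.
Context {d : measure_display} {Omega : measurableType d}.

(* Expectation of F over i.i.d. draws w 0, ..., w (k-1) from P
   (iterated integral; coordinates >= k are fixed to an arbitrary point). *)
Fixpoint iid_expect (P : probability Omega R) (k : nat)
    (F : (nat -> Omega) -> R) : \bar R :=
  match k with
  | 0 => (F (fun _ => point))%:E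
  | k'.+1 => (\int[P]_w iid_expect P k'
                 (fun g => F (fun i => if i == k' then w else g i)))%E
  end.

Definition type_prob (P : probability Omega R) (theta : Omega -> 'I_n) (i : 'I_n) : R :=
  fine (P (theta @^-1` [set i])%classic).

Definition mean_b (P : probability Omega R) (b : Omega -> 'I_m -> R) (j : 'I_m) : R :=
  fine (\int[P]_w (b w j)%:E)%E.

Definition regret_alg2 (P : probability Omega R) (Rv : 'I_n -> R) (A : 'I_m -> 'I_n -> R)
  (theta : Omega -> 'I_n) (b : Omega -> 'I_m -> R) (mulow blow bbar L : R)
  (sel : ('I_m -> R) -> ('I_n -> R) -> lpsol) (T : nat) : \bar R :=
  iid_expect P T (fun w =>
    let th := fun t => theta (w t.-1) in
    let bb := fun t => b (w t.-1) in
    offline_opt Rv A th bb T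
    - alg_reward Rv A sel (alg_kappa mulow blow bbar L T) (alg_W A blow) th bb T).

End Prob.
End Defs.

(* Main.v *)
Require Import Defs.
From HB Require Import structures.
From mathcomp Require Import all_boot all_order all_algebra.
From mathcomp Require Import all_classical all_reals.
From mathcomp Require Import ereal exp measure lebesgue_measure lebesgue_integral probability.
From mathcomp Require Import sequences numfun measurable_realfun.
From mathcomp Require Import ring lra zify.

Import Order.TTheory GRing.Theory Num.Theory.
Local Open Scope ring_scope.
Local Open Scope classical_set_scope.

(* Weak duality with the multipliers (y, v) of the nominal LP bounds the offline
   optimum by v . (arrivals) + y . (supply).  The multipliers exist because, at a unique
   non-degenerate optimum, the m + n basic columns are independent.  On the event that
   every window of kappa periods has empirical means within delta = min(L, blow, mulow)/4
   of the true ones, each re-solved LP has the nominal basis, so its value is exactly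
   v . mu + y . B for the data of its block; the quota of a fractional type is moreover
   smaller than the arrivals of the next block, hence is exhausted there.  The accepted
   quantities therefore track the LP solutions up to O(kappa), which the warm-up inventory
   absorbs, and the regret on this event is O(kappa) = O(ln T).  By a Chernoff bound the
   complement has probability O(T^-1), while the regret never exceeds O(T). *)

(** * Linear-programming duality at a non-degenerate optimum *)

(** Errors do not add up over the roughly [T / kappa] blocks because a single pair of multipliers
    serves all of them. Complementary slackness refers only to the basis, so [y] and [v] price each
    re-solved block exactly, and the same linear functional of the total data bounds the offline
    optimum. The block values telescope, and what is lost is priced on boundary blocks only. The
    inventory test threatens to make acceptance depend on the whole past. It is eliminated by an
    induction: while acceptances track the quotas, the stock covers any order, so only the quotas
    decide, and this preserves the tracking. On the probabilistic side no event is integrated, since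
    an arbitrary [sel] may destroy measurability. The regret is dominated pointwise by a constant
    plus a sum of products of one-coordinate exponentials, which iterated integration evaluates. The
    constant [C] makes each window fail at rate [T^-2]: one factor [T] pays for the number of
    windows, the other for the worst-case regret. *)

Section Duality.
Context {R : realType}.

Lemma feasible_step {K : finType} (x d : K -> R) :
  (forall k, 0 <= x k) -> (forall k, x k = 0 -> 0 <= d k) ->
  exists2 e : R, 0 < e & forall k, 0 <= x k + e * d k.
Proof.
(* The step is the inverse of [D], which dominates every ratio [|d k| / x k]. Where [x k = 0] the
   ratio is 0 by the convention on division, and the leading 1 keeps [D] positive. *)
move=> x0 d0; pose D := 1 + \sum_k `|d k| / x k.
have S0 k : 0 <= `|d k| / x k by rewrite divr_ge0.
have D1 : 1 <= D by rewrite lerDl sumr_ge0.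
have Dgt0 : 0 < D by lra.
exists D^-1 => [|k]; first by rewrite invr_gt0.
have [xk0|xk0] := eqVneq (x k) 0.
  by rewrite xk0 add0r mulr_ge0 ?invr_ge0 ?d0// ltW.
have xk : 0 < x k by rewrite lt_def xk0 x0.
have : `|d k| / x k <= D.
  by rewrite /D (bigD1 k)//= addrCA lerDl addr_ge0 ?sumr_ge0.
rewrite ler_pdivrMr// => dk.
have : D^-1 * `|d k| <= x k by rewrite mulrC ler_pdivrMr// mulrC.
have : - (D^-1 * `|d k|) <= D^-1 * d k.
  by rewrite -mulrN ler_pM2l ?invr_gt0// lerNl -normrN ler_norm.
lra.
Qed.

(** These are the simplex multipliers [M^-1 cB]. Uniqueness makes the columns of the support
    independent, the count [p] makes them a square matrix [M], and a violated reduced-cost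
    inequality would give a feasible direction that improves the objective. *)
Lemma nondegenerate_multipliers {K : finType} {p : nat} (a : K -> 'rV[R]_p) (c x : K -> R) :
  (forall k, 0 <= x k) ->
  (forall x' : K -> R, (forall k, 0 <= x' k) ->
     \sum_k x' k *: a k = \sum_k x k *: a k ->
     \sum_k c k * x k <= \sum_k c k * x' k -> x' =1 x) ->
  #|[set k | 0 < x k]%SET| = p ->
  exists l : 'cV[R]_p, (forall k, c k <= (a k *m l) 0 0) /\
    (forall k, 0 < x k -> c k = (a k *m l) 0 0).
Proof.
move=> x0 xU; set S := [set k | 0 < x k]%SET => Sp; subst p.
(* Uniqueness in the form used twice below: a feasible direction in the kernel of the constraints
   that does not lower the objective is zero. *)
have dU (d : K -> R) : \sum_k d k *: a k = 0 -> (forall k, k \notin S -> 0 <= d k) ->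
    0 <= \sum_k c k * d k -> forall k, d k = 0.
  move=> da dS cd k.
  have [e e0 xe] : exists2 e : R, 0 < e & forall k, 0 <= x k + e * d k.
    apply: feasible_step => // k' xk'; apply: dS.
    by rewrite inE xk' ltxx.
  have := xU _ xe.
  have -> : \sum_k (x k + e * d k) *: a k = \sum_k x k *: a k.
    under eq_bigr do rewrite scalerDl -scalerA.
    by rewrite big_split/= -scaler_sumr da scaler0 addr0.
  have -> : \sum_k c k * (x k + e * d k) = \sum_k c k * x k + e * \sum_k c k * d k.
    under eq_bigr do rewrite mulrDr mulrCA.
    by rewrite big_split/= -mulr_sumr.
  rewrite lerDl mulr_ge0 ?(ltW e0)// => /(_ erefl isT k)/eqP.
  by rewrite -subr_eq0 addrAC subrr add0r mulf_eq0 gt_eqF//= => /eqP.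
pose M : 'M[R]_#|S| := \matrix_i a (enum_val i).
pose cB : 'cV[R]_#|S| := \col_i c (enum_val i).
(* Extension by zero of a vector indexed by the support. *)
pose ext (u : 'rV[R]_#|S|) k : R := \sum_i u 0 i * (enum_val i == k)%:R.
have extS u k : k \notin S -> ext u k = 0.
  move=> kS; apply: big1 => i _; case: eqVneq => [ik|]; last by rewrite mulr0.
  by rewrite -ik enum_valP in kS.
have extE u i : ext u (enum_val i) = u 0 i.
  rewrite /ext (bigD1 i)//= eqxx mulr1 big1 ?addr0// => j ji.
  by rewrite (inj_eq enum_val_inj) (negbTE ji) mulr0.
have ext_sum (V : lmodType R) (u : 'rV[R]_#|S|) (F : K -> V) :
    \sum_k ext u k *: F k = \sum_i u 0 i *: F (enum_val i).
  rewrite /ext; under eq_bigr do rewrite scaler_suml.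
  rewrite exchange_big/=; apply: eq_bigr => i _.
  rewrite (bigD1 (enum_val i))//= eqxx mulr1 big1 ?addr0// => k ki.
  by rewrite eq_sym (negbTE ki) mulr0 scale0r.
have ext_a u : \sum_k ext u k *: a k = u *m M.
  by rewrite ext_sum mulmx_sum_row; apply: eq_bigr => i _; rewrite rowK.
have ext_c u : \sum_k c k * ext u k = (u *m cB) 0 0.
  under eq_bigr do rewrite mulrC.
  rewrite (ext_sum R^o) mxE; apply: eq_bigr => i _; by rewrite !mxE.
have MU : M \in unitmx.
  rewrite -row_free_unit; apply: inj_row_free => u uM.
  (* A kernel vector on the support can be followed in both directions, so its sign may be chosen to
     keep the objective from decreasing. *)
  wlog uc : u uM / 0 <= (u *m cB) 0 0 => [hw|].
    have [/hw->//|/ltW uc] := leP 0 ((u *m cB) 0 0).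
    apply/eqP; rewrite -oppr_eq0; apply/eqP/hw; first by rewrite mulNmx uM oppr0.
    by rewrite mulNmx mxE oppr_ge0.
  apply/rowP => i; rewrite mxE -extE; apply: dU.
  - by rewrite ext_a.
  - by move=> k /extS ->.
  - by rewrite ext_c.
exists (invmx M *m cB); have lS k : 0 < x k -> c k = (a k *m (invmx M *m cB)) 0 0.
  move=> xk; have kS : k \in S by rewrite inE.
  have -> : a k = row (enum_rank_in kS k) M by rewrite rowK enum_rankK_in.
  by rewrite -row_mul mulKVmx// !mxE enum_rankK_in.
split => // k; have [kS|kS] := boolP (k \in S).
  by rewrite lS//; rewrite inE in kS.
rewrite leNgt; apply/negP; set u := a k *m invmx M => ck.
(* The simplex direction: [k] enters the basis and the basic variables compensate. It is profitable
   by [ck], yet its entry at [k] is 1. *)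
pose d k' := (k' == k)%:R - ext u k'.
have sumd (V : lmodType R) (F : K -> V) :
    \sum_k' d k' *: F k' = F k - \sum_k' ext u k' *: F k'.
  rewrite /d; under eq_bigr do rewrite scalerBl.
  rewrite sumrB (bigD1 k)//= eqxx scale1r big1 ?addr0// => k' k'k.
  by rewrite (negbTE k'k) scale0r.
have : d k = 0.
  apply: dU.
  - by rewrite sumd ext_a mulmxKV// subrr.
  - by move=> k' k'S; rewrite /d extS// subr0.
  - under eq_bigr do rewrite mulrC.
    rewrite (sumd R^o) subr_ge0.
    under eq_bigr do rewrite /GRing.scale/= mulrC.
    by rewrite ext_c -mulmxA; apply: ltW.
by rewrite /d extS// eqxx subr0 => /eqP; rewrite oner_eq0.
Qed.
End Duality.

Section InducedLP.
Context {R : realType} {n m : nat} (Rv : 'I_n -> R) (A : 'I_m -> 'I_n -> R).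

Definition dual_feasible (y : 'I_m -> R) (v : 'I_n -> R) : Prop :=
  [/\ forall j, 0 <= y j, forall i, 0 <= v i &
      forall i, Rv i <= v i + \sum_j A j i * y j].

Definition compl_slack (y : 'I_m -> R) (v : 'I_n -> R)
    (bs : {set 'I_n} * {set 'I_n} * {set 'I_m}) : Prop :=
  [/\ forall i, i \in bs.1.1 -> Rv i = v i + \sum_j A j i * y j,
      forall i, i \in bs.1.2 -> v i = 0 &
      forall j, j \in bs.2 -> y j = 0].

(** All variables form one family of columns in dimension [m + n]. The reduced-cost inequality at an
    [S] column reads [0 <= y j], at a [V] column [0 <= v i], and at an [X] column it is the dual
    constraint; equality on the support is complementary slackness. *)
Lemma nondegenerate_dual (B : 'I_m -> R) (mu : 'I_n -> R) (s : @lpsol R n m) :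
  lp_unique_optimal Rv A B mu s ->
  (#|(lp_basis s).1.1| + #|(lp_basis s).1.2| + #|(lp_basis s).2| = m + n)%N ->
  exists y v, dual_feasible y v /\ compl_slack y v (lp_basis s).
Proof.
case: s => [[X V] Sv] /= [[[fe1 fe2 fX fV fS] opt] uniq] card.
pose K : finType := ('I_n + 'I_n + 'I_m)%type.
pose arow (k : K) (j : 'I_m) : R := match k with
  | inl (inl i) => A j i | inl (inr _) => 0 | inr j' => (j' == j)%:R end.
pose brow (k : K) (i : 'I_n) : R := match k with
  | inl (inl i') | inl (inr i') => (i' == i)%:R | inr _ => 0 end.
pose a (k : K) : 'rV[R]_(m + n) := row_mx (\row_j arow k j) (\row_i brow k i).
pose c (k : K) : R := match k with inl (inl i) => Rv i | _ => 0 end.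
pose var (X V : 'I_n -> R) (S : 'I_m -> R) (k : K) : R := match k with
  | inl (inl i) => X i | inl (inr i) => V i | inr j => S j end.
have sumK (F : K -> R) : \sum_k F k =
    \sum_i F (inl (inl i)) + \sum_i F (inl (inr i)) + \sum_j F (inr j).
  by rewrite big_sumType/= big_sumType.
have sum_eq p (F : 'I_p -> R) i : \sum_j F j * (j == i)%:R = F i.
  rewrite (bigD1 i)//= eqxx mulr1 big1 ?addr0// => j ji.
  by rewrite (negbTE ji) mulr0.
have sum_a X' V' S' : \sum_k var X' V' S' k *: a k =
    row_mx (\row_j (\sum_i A j i * X' i + S' j)) (\row_i (X' i + V' i)).
  apply/rowP => q; rewrite summxE; have [j ->|i ->] := split_ordP q.
    rewrite row_mxEl mxE; under eq_bigr do rewrite mxE row_mxEl mxE.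
    rewrite sumK/= sum_eq [X in _ + X + _]big1 ?addr0//; last by move=> *; rewrite mulr0.
    by congr (_ + _); apply: eq_bigr => i _; rewrite mulrC.
  rewrite row_mxEr mxE; under eq_bigr do rewrite mxE row_mxEr mxE.
  by rewrite sumK/= !sum_eq [X in _ + X]big1 ?addr0// => *; rewrite mulr0.
have sum_c X' V' S' : \sum_k c k * var X' V' S' k = lp_obj Rv (X', V', S').
  rewrite /lp_obj sumK/= -[RHS]addr0 -[RHS]addr0.
  by congr (_ + _ + _); apply: big1 => i _; rewrite mul0r.
have [||| l [lge leq]] := @nondegenerate_multipliers R K (m + n) a c (var X V Sv).
- by case=> [[i|i]|j] /=.
- move=> x' x'0.
  pose X' i := x' (inl (inl i)); pose V' i := x' (inl (inr i)); pose S' j := x' (inr j).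
  have x'E : x' =1 var X' V' S' by case=> [[i|i]|j].
  rewrite (eq_bigr (fun k => var X' V' S' k *: a k)); last by move=> k _; rewrite -x'E.
  rewrite [in X in _ -> _ <= X -> _](eq_bigr (fun k => c k * var X' V' S' k)); last first.
    by move=> k _; rewrite -x'E.
  rewrite !sum_a !sum_c => /eq_row_mx[/rowP e1 /rowP e2] ob.
  have fs' : lp_feasible A B mu (X', V', S').
    split; last by move=> j; exact: x'0.
    - by move=> j; have := e1 j; rewrite !mxE fe1.
    - by move=> i; have := e2 i; rewrite !mxE fe2.
    - by move=> i; exact: x'0.
    - by move=> i; exact: x'0.
  have [eX eV eS] : lpsol_eq (X', V', S') (X, V, Sv).
    apply: uniq; split=> // s' /opt /le_trans; exact.
  by move=> k; rewrite x'E; case: k => [[i|i]|j] /=; rewrite ?eX ?eV ?eS.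
- have card_sum (T : finType) (P : pred T) : #|[set i | P i]%SET| = (\sum_i P i)%N.
    by rewrite cardsE -sum1_card big_mkcond.
  by rewrite -card !card_sum !big_sumType.
have al k : (a k *m l) 0 0 =
    \sum_j arow k j * l (lshift n j) 0 + \sum_i brow k i * l (rshift m i) 0.
  rewrite mxE big_split_ord/=; congr (_ + _); apply: eq_bigr => i _.
    by rewrite row_mxEl mxE.
  by rewrite row_mxEr mxE.
have sum_eq' p (F : 'I_p -> R) i : \sum_j (i == j)%:R * F j = F i.
  by rewrite -[RHS]sum_eq; apply: eq_bigr => j _; rewrite mulrC eq_sym.
pose y j := l (lshift n j) 0; pose v i := l (rshift m i) 0.
have aX i : (a (inl (inl i)) *m l) 0 0 = v i + \sum_j A j i * y j.
  by rewrite al/= sum_eq' addrC.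
have aV i : (a (inl (inr i)) *m l) 0 0 = v i.
  by rewrite al/= sum_eq' big1 ?add0r// => *; rewrite mul0r.
have aS j : (a (inr j) *m l) 0 0 = y j.
  by rewrite al/= sum_eq' [X in _ + X]big1 ?addr0// => *; rewrite mul0r.
exists y, v; split; split.
- by move=> j; have := lge (inr j); rewrite aS.
- by move=> i; have := lge (inl (inr i)); rewrite aV.
- by move=> i; have := lge (inl (inl i)); rewrite aX.
- by move=> i /=; rewrite inE => /(leq (inl (inl i))); rewrite aX.
- by move=> i /=; rewrite inE => /(leq (inl (inr i))); rewrite aV.
- by move=> i /=; rewrite inE => /(leq (inr i)); rewrite aS.
Qed.

Lemma weak_duality (y : 'I_m -> R) (v : 'I_n -> R) (B : 'I_m -> R) (mu X : 'I_n -> R) :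
  dual_feasible y v ->
  (forall i, 0 <= X i) -> (forall i, X i <= mu i) ->
  (forall j, \sum_i A j i * X i <= B j) ->
  \sum_i Rv i * X i <= \sum_i v i * mu i + \sum_j y j * B j.
Proof.
move=> [y0 v0 Rle] X0 Xmu AXB.
apply: (@le_trans _ _ (\sum_i v i * X i + \sum_j y j * (\sum_i A j i * X i))).
  under [X in _ <= _ + X]eq_bigr do rewrite mulr_sumr.
  rewrite exchange_big/= -big_split/=; apply: ler_sum => i _.
  apply: (le_trans (ler_wpM2r (X0 i) (Rle i))).
  by rewrite mulrDl mulr_suml lerD2l; apply: ler_sum => j _; rewrite mulrA [A j i * _]mulrC.
by apply: lerD; apply: ler_sum => k _; apply: ler_wpM2l.
Qed.

(** The right-hand sides are arbitrary: only the support matters, so multipliers fixed once evaluate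
    every LP whose solution is supported in [bs]. *)
Lemma compl_slack_obj (y : 'I_m -> R) (v : 'I_n -> R) bs (B : 'I_m -> R) (mu : 'I_n -> R)
    (s : @lpsol R n m) :
  compl_slack y v bs -> lp_feasible A B mu s ->
  (forall i, i \notin bs.1.1 -> s.1.1 i = 0) ->
  (forall i, i \notin bs.1.2 -> s.1.2 i = 0) ->
  (forall j, j \notin bs.2 -> s.2 j = 0) ->
  lp_obj Rv s = \sum_i v i * mu i + \sum_j y j * B j.
Proof.
move=> [cX cV cS]; case: s => [[X V] Sv] /= [e1 e2 _ _ _] nX nV nS.
have -> : \sum_i v i * mu i = \sum_i v i * X i.
  apply: eq_bigr => i _; rewrite -e2 mulrDr.
  have [/cV->|/nV->] := boolP (i \in bs.1.2); by rewrite ?mulr0 ?mul0r ?addr0.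
have -> : \sum_j y j * B j = \sum_j y j * \sum_i A j i * X i.
  apply: eq_bigr => j _; rewrite -e1 mulrDr.
  have [/cS->|/nS->] := boolP (j \in bs.2); by rewrite ?mulr0 ?mul0r ?addr0.
under [X in _ = _ + X]eq_bigr do rewrite mulr_sumr.
rewrite exchange_big/= -big_split/=; apply: eq_bigr => i _ /=.
have [/cX->|/nX->] := boolP (i \in bs.1.1); last first.
  by rewrite !mulr0 big1 ?addr0// => j _; rewrite !mulr0.
by rewrite mulrDl mulr_suml; congr (_ + _); apply: eq_bigr => j _; rewrite mulrA [A j i * _]mulrC.
Qed.

(** Block data are sums over [kappa] periods, whereas stability concerns perturbations of per-period
    data; homogeneity passes from one to the other. *)
Lemma lp_optimal_scale (k : R) (B : 'I_m -> R) (mu : 'I_n -> R) (s : @lpsol R n m) :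
  0 < k -> lp_optimal Rv A B mu s ->
  lp_optimal Rv A (fun j => k * B j) (fun i => k * mu i)
    (fun i => k * s.1.1 i, fun i => k * s.1.2 i, fun j => k * s.2 j).
Proof.
have objZ c (s' : @lpsol R n m) : lp_obj Rv
    (fun i => c * s'.1.1 i, fun i => c * s'.1.2 i, fun j => c * s'.2 j) = c * lp_obj Rv s'.
  by rewrite /lp_obj mulr_sumr; apply: eq_bigr => i _; rewrite mulrCA.
have feasZ c B' mu' (s' : @lpsol R n m) : 0 < c -> lp_feasible A B' mu' s' ->
    lp_feasible A (fun j => c * B' j) (fun i => c * mu' i)
      (fun i => c * s'.1.1 i, fun i => c * s'.1.2 i, fun j => c * s'.2 j).
  move=> c0; case: s' => [[X V] Sv] [e1 e2 X0 V0 S0]; split=> /= [j|i|i|i|j].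
  - rewrite -e1 mulrDr mulr_sumr; congr (_ + _); apply: eq_bigr => i _.
    by rewrite mulrCA.
  - by rewrite -e2 mulrDr.
  - by rewrite mulr_ge0// ltW.
  - by rewrite mulr_ge0// ltW.
  - by rewrite mulr_ge0// ltW.
move=> k0 [fs opt]; split; first exact: feasZ.
move=> s' fs'; rewrite objZ -ler_pdivrMl// -objZ; apply: opt.
have : lp_feasible A (fun j => k^-1 * (k * B j)) (fun i => k^-1 * (k * mu i)) 
  (fun i => k^-1 * s'.1.1 i, fun i => k^-1 * s'.1.2 i, fun j => k^-1 * s'.2 j).
  by apply: feasZ; rewrite ?invr_gt0.
case=> [e1 e2 X0 V0 S0]; split => // i; rewrite ?e1 ?e2 mulKf// gt_eqF//.
Qed.

(** The multipliers and the set [IV] of fractional or rejected types come from the nominal LP,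
    before [delta], [k] and the data. The margin [k * (L - delta)] on [V] is what later leaves room
    for the quota among the arrivals of the next block. *)
Lemma stable_basis (B : 'I_m -> R) (mu : 'I_n -> R) (L : R) :
  lp_nondegenerate Rv A B mu ->
  (forall (Bh : 'I_m -> R) (muh : 'I_n -> R),
      (forall j, `|Bh j - B j| <= L) -> (forall i, `|muh i - mu i| <= L) ->
      same_opt_basis Rv A B mu Bh muh) ->
  exists y v (IV : {set 'I_n}), dual_feasible y v /\
    forall (delta : R) (k : R) (Bh : 'I_m -> R) (muh : 'I_n -> R) (s : @lpsol R n m),
      0 < k -> delta <= L ->
      (forall j, `|Bh j - k * B j| <= k * delta) ->
      (forall i, `|muh i - k * mu i| <= k * delta) ->
      lp_optimal Rv A Bh muh s ->
      [/\ forall i, (s.1.2 i == 0) = (i \notin IV),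
          forall i, i \in IV -> k * (L - delta) < s.1.2 i &
          lp_obj Rv s = \sum_i v i * muh i + \sum_j y j * Bh j].
Proof.
move=> [s0 [us0 card]] stable.
have [y [v [yv cs]]] := nondegenerate_dual _ _ _ us0 card.
exists y, v, (lp_basis s0).1.2; split=> // delta k Bh muh s k0 dL Bk muk opts.
set bs := lp_basis s0 in cs *.
have near_basis Bh' muh' : (forall j, `|Bh' j - B j| <= L) ->
    (forall i, `|muh' i - mu i| <= L) ->
    exists2 s2, lp_unique_optimal Rv A Bh' muh' s2 & lp_basis s2 = lp_basis s0.
  move=> /stable h /h [s1 [s2 [us1 us2 bs12]]]; exists s2 => //; rewrite bs12.
  have [eX eV eS] := us0.2 _ us1.1.
  by congr (_, _, _); apply/setP => i; rewrite !inE ?eX ?eV ?eS.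
pose B1 j := k^-1 * Bh j; pose mu1 i := k^-1 * muh i.
have dev (z w : R) : `|z - k * w| <= k * delta -> `|k^-1 * z - w| <= delta.
  move=> h; rewrite -(ler_pM2l k0) -{1}[k]gtr0_norm// -normrM mulrBr mulVKf//.
  by rewrite gt_eqF.
have B1d j : `|B1 j - B j| <= delta by exact: dev.
have mu1d i : `|mu1 i - mu i| <= delta by exact: dev.
pose sk : @lpsol R n m :=
  (fun i => k^-1 * s.1.1 i, fun i => k^-1 * s.1.2 i, fun j => k^-1 * s.2 j).
have optk : lp_optimal Rv A B1 mu1 sk by apply: lp_optimal_scale; rewrite ?invr_gt0.
have [||s2 us2 bs2] := near_basis B1 mu1.
- by move=> j; exact: (le_trans (B1d j)).
- by move=> i; exact: (le_trans (mu1d i)).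
have [eX eV eS] := us2.2 _ optk.
have ki : 0 < k^-1 by rewrite invr_gt0.
have bsX i : (i \in bs.1.1) = (0 < s.1.1 i).
  by rewrite /bs -bs2 inE -eX/= pmulr_rgt0.
have bsV i : (i \in bs.1.2) = (0 < s.1.2 i).
  by rewrite /bs -bs2 inE -eV/= pmulr_rgt0.
have bsS j : (j \in bs.2) = (0 < s.2 j).
  by rewrite /bs -bs2 inE -eS/= pmulr_rgt0.
have fs := opts.1; case: s opts @sk optk eX eV eS bsX bsV bsS fs
  => [[X V] Sv] opts sk optk /= eX eV eS bsX bsV bsS [e1 e2 X0 V0 S0].
have eq0 (x : R) : 0 <= x -> ~~ (0 < x) -> x = 0.
  by move=> x0; rewrite -leNgt => x1; apply/eqP; rewrite eq_le x1.
split.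
- by move=> i; rewrite bsV lt_def V0 andbT negbK.
(* Lowering mu_i by V_i, a perturbation of size at most L, would make V_i leave the basis. *)
- move=> i iIV; rewrite ltNge; apply/negP => Vi.
  have Vi0 : 0 < V i by rewrite -bsV.
  pose h := k^-1 * V i.
  have h0 : 0 < h by rewrite mulr_gt0.
  have hL : h <= L - delta by rewrite ler_pdivrMl.
  pose mu2 i' := mu1 i' - (if i' == i then h else 0).
  have [||s3 us3 bs3] := near_basis B1 mu2.
  + by move=> j; exact: (le_trans (B1d j)).
  + move=> i'; rewrite /mu2; have := mu1d i'; case: eqP => _ d'; last by rewrite subr0; lra.
    by rewrite ler_norml; move: d'; rewrite ler_norml => /andP[? ?]; lra.
  pose s4 : @lpsol R n m := (sk.1.1, fun i' => sk.1.2 i' - (if i' == i then h else 0), sk.2).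
  have fs4 : lp_feasible A B1 mu2 s4.
    have [f1 f2 f3 f4 f5] := optk.1; split => //.
    * by move=> i'; rewrite /mu2 -f2 addrA.
    * move=> i' /=; case: eqVneq => [->|_]; first by rewrite /h subrr.
      by rewrite subr0; exact: f4.
  (* The nominal multipliers certify optimality: [s4] is still supported in the basis, so its value
     equals the dual bound for the data [B1], [mu2]. *)
  have opt4 : lp_optimal Rv A B1 mu2 s4.
    split; first exact: fs4.
    move=> [[X' V'] S'] [g1 g2 g3 g4 g5].
    rewrite (compl_slack_obj _ _ _ _ _ _ cs fs4); first last.
    + by move=> j; rewrite bsS => /eq0/=->//; rewrite mulr0.
    + move=> i'; rewrite bsV => /eq0/= V'0; case: eqVneq => [i'i|_].
        by rewrite i'i/= subrr.
      by rewrite V'0// mulr0 subr0.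
    + by move=> i'; rewrite bsX => /eq0/=->//; rewrite mulr0.
    rewrite /lp_obj/=; apply: weak_duality => //.
    + by move=> i'; rewrite -g2 lerDl.
    + by move=> j; rewrite -g1 lerDl.
  have [_ /(_ i)/= + _] := us3.2 _ opt4.
  rewrite eqxx subrr => s3i.
  have : i \in (lp_basis s3).1.2 by rewrite bs3.
  by rewrite inE -s3i ltxx.
- apply: (compl_slack_obj _ _ _ _ _ _ cs) => //=.
  + by move=> i; rewrite bsX => /eq0->.
  + by move=> i; rewrite bsV => /eq0->.
  + by move=> j; rewrite bsS => /eq0->.
Qed.
End InducedLP.

(** * Bounds valid on every run *)

Section CumulativeSums.
Context {R : realType}.

Definition csum (F : nat -> R) (k : nat) : R := \sum_(1 <= t < k.+1) F t.

Lemma csum0 F : csum F 0 = 0.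
Proof. by rewrite /csum big_geq. Qed.

Lemma csumS F k : csum F k.+1 = csum F k + F k.+1.
Proof. by rewrite /csum big_nat_recr. Qed.

Lemma csum_window F s k : \sum_(s.+1 <= t < (s + k).+1) F t = csum F (s + k) - csum F s.
Proof.
rewrite /csum (@big_cat_nat _ _ _ s.+1 1)//= ?ltnS ?leq_addr//.
by rewrite addrAC subrr add0r.
Qed.

Lemma csum_le F s k : (forall t, 0 <= F t) -> (s <= k)%N -> csum F s <= csum F k.
Proof.
move=> F0 /subnKC <-; rewrite -subr_ge0 -csum_window.
exact: sumr_ge0.
Qed.

Lemma csum_le_dist F s k : (forall t, F t <= 1) -> (s <= k)%N -> csum F k - csum F s <= (k - s)%:R.
Proof.
move=> F1 sk; rewrite -{1}(subnKC sk) -csum_window.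
apply: (le_trans (ler_sum _ (fun t _ => F1 t))).
by rewrite sumr_const_nat subSS addKn lexx.
Qed.

Lemma sum_csum {n : nat} (c : 'I_n -> R) (F : 'I_n -> nat -> R) k :
  \sum_i c i * csum (F i) k = csum (fun t => \sum_i c i * F i t) k.
Proof.
rewrite /csum exchange_big/=; apply: eq_bigr => i _.
by rewrite mulr_sumr.
Qed.

Lemma sum_indicator {n : nat} (c : 'I_n -> R) (i0 : 'I_n) (z : bool) :
  \sum_i c i * (z && (i0 == i))%:R = c i0 * z%:R.
Proof.
rewrite (bigD1 i0)//= eqxx andbT big1 ?addr0// => i ii0.
by rewrite eq_sym (negbTE ii0) andbF mulr0.
Qed.
End CumulativeSums.

Section AnyRun.
Context {R : realType} {n m : nat} (Rv : 'I_n -> R) (A : 'I_m -> 'I_n -> R).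
Context (sel : ('I_m -> R) -> ('I_n -> R) -> @lpsol R n m) (kappa W : nat).
Context (th : nat -> 'I_n) (bb : nat -> 'I_m -> R).
Hypothesis bb_ge0 : forall t j, 0 <= bb t j.

Let state k := alg_state A sel kappa W th bb k.
Let x t := alg_x A sel kappa W th bb t.

Definition accepted (k : nat) (i : 'I_n) : R :=
  csum (fun t => (alg_x A sel kappa W th bb t && (th t == i))%:R) k.
Definition arrived (k : nat) (i : 'I_n) : R := csum (fun t => (th t == i)%:R) k.
Definition supplied (k : nat) (j : 'I_m) : R := csum (fun t => bb t j) k.

Lemma alg_xS k : x k.+1 = [&& (W * kappa < k.+1)%N,
    [forall j, A j (th k.+1) <= (state k).1.2 j] &
    (th k.+1 \in (state k).2) || (1 <= (state k).1.1 (th k.+1))].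
Proof.
rewrite /x /alg_x /= /alg_decide -/(state k); case: (state k) => [[Phi ell] Ih] /=.
rewrite [(W * kappa < _)%N]ltnNge; case: (k.+1 <= W * kappa)%N => //=.
by case: (th k.+1 \in Ih); rewrite ?andbT// andbC.
Qed.

Lemma stateS_ell k j : (state k.+1).1.2 j =
  (state k).1.2 j + bb k.+1 j - A j (th k.+1) * (x k.+1)%:R.
Proof. by rewrite /x /alg_x/= -/(state k); case: (state k) => [[Phi ell] Ih]. Qed.

Lemma stateS_Phi k i : (state k.+1).1.1 i = (state k).1.1 i
  - [&& i == th k.+1, th k.+1 \notin (state k).2 & x k.+1]%:R
  + (if (W * kappa <= k.+1)%N && (kappa %| k.+1)%N
     then (sel (alg_Bhat kappa bb k.+1) (alg_muhat kappa th k.+1)).1.1 i else 0).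
Proof.
rewrite /x /alg_x/= -/(state k); case: (state k) => [[Phi ell] Ih] /=.
by case: ifP => _; case: ifP => _; rewrite ?addr0 ?subr0.
Qed.

Lemma stateS_Ih k : (state k.+1).2 = if (W * kappa <= k.+1)%N && (kappa %| k.+1)%N
  then [set i | (sel (alg_Bhat kappa bb k.+1) (alg_muhat kappa th k.+1)).1.2 i == 0]%SET
  else (state k).2.
Proof. by rewrite /= -/(state k); case: (state k) => [[Phi ell] Ih] /=. Qed.

Lemma inventoryE k j : (state k).1.2 j = supplied k j - \sum_i A j i * accepted k i.
Proof.
rewrite /supplied /accepted sum_csum.
elim: k => [|k IH]; first by rewrite !csum0 subr0.
by rewrite !csumS stateS_ell IH sum_indicator; ring.
Qed.

Lemma inventory_ge0 k j : 0 <= (state k).1.2 j.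
Proof.
elim: k => [//|k IH]; rewrite stateS_ell.
have b0 := bb_ge0 k.+1 j.
have [xk|] := boolP (x k.+1); last by rewrite mulr0 subr0 => _; exact: addr_ge0.
move: xk; rewrite alg_xS => /and3P[_ /forallP/(_ j) Aj _]; rewrite mulr1.
by lra.
Qed.

Lemma alg_rewardE T : alg_reward Rv A sel kappa W th bb T = \sum_i Rv i * accepted T i.
Proof.
rewrite /accepted sum_csum; apply: eq_bigr => t _.
by rewrite sum_indicator.
Qed.

Lemma sum_ord_csum (F : nat -> R) T : \sum_(l < T) F l.+1 = csum F T.
Proof. by rewrite /csum big_add1/= big_mkord. Qed.

(** The run is itself an admissible offline choice because its inventory never becomes negative.
    Nonnegativity of the regret is what allows comparing integrals without measurability. *)
Lemma alg_reward_le_offline_opt T :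
  alg_reward Rv A sel kappa W th bb T <= offline_opt Rv A th bb T.
Proof.
pose xf : {ffun 'I_T -> bool} := [ffun l : 'I_T => x l.+1].
have -> : alg_reward Rv A sel kappa W th bb T = \sum_(l < T) Rv (th l.+1) * (xf l)%:R.
  rewrite /alg_reward -/(csum _ _) -sum_ord_csum.
  by apply: eq_bigr => l _; rewrite ffunE.
apply: le_bigmax_cond; apply/forallP => j; apply/forallP => k.
have prefix (F : nat -> R) : \sum_(l : 'I_T | (l <= k)%N) F l.+1 = csum F k.+1.
  rewrite -sum_ord_csum (big_ord_widen _ (fun l => F l.+1) (ltn_ord k)).
  by apply: eq_bigl => l; rewrite ltnS.
under eq_bigr do rewrite ffunE.
rewrite (prefix (fun t => A j (th t) * (x t)%:R)) (prefix (bb^~ j)).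
have := inventory_ge0 k.+1 j; rewrite inventoryE subr_ge0; congr (_ <= _).
rewrite sum_csum; apply: eq_bigr => t _.
by rewrite sum_indicator.
Qed.

(** Keeping only the prefix constraint of the final period relaxes the offline problem to the
    induced LP with the total arrivals and supplies, where weak duality applies. *)
Lemma offline_opt_le_dual T (y : 'I_m -> R) (v : 'I_n -> R) :
  dual_feasible Rv A y v ->
  offline_opt Rv A th bb T <= \sum_i v i * arrived T i + \sum_j y j * supplied T j.
Proof.
move=> dyv; have [y0 v0 _] := dyv.
have arr0 i : 0 <= arrived T i by rewrite sumr_ge0.
have sup0 j : 0 <= supplied T j by rewrite sumr_ge0.
apply: bigmax_le => [|xf /forallP xfeas].
  by apply: addr_ge0; apply: sumr_ge0 => k _; exact: mulr_ge0.
pose X i : R := \sum_(l < T) (xf l && (th l.+1 == i))%:R.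
have sumX (c : 'I_n -> R) : \sum_i c i * X i = \sum_(l < T) c (th l.+1) * (xf l)%:R.
  under eq_bigr do rewrite mulr_sumr.
  by rewrite exchange_big/=; apply: eq_bigr => l _; rewrite sum_indicator.
rewrite -sumX; apply: (weak_duality Rv A) => // [i|i|j].
- exact: sumr_ge0.
- rewrite /arrived -sum_ord_csum; apply: ler_sum => l _.
  by rewrite ler_nat; case: (xf l).
- rewrite sumX /supplied -sum_ord_csum; case: T xf {X sumX arr0 sup0} xfeas => [|T] xf xfeas.
    by rewrite !big_ord0 lexx.
  have /forallP/(_ ord_max) := xfeas j.
  rewrite (eq_bigl xpredT) => [|l]; last by rewrite /= -ltnS ltn_ord.
  rewrite [X in _ <= X -> _](eq_bigl xpredT)// => l.
  by rewrite /= -ltnS ltn_ord.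
Qed.

Lemma regret_trivial_bound T :
  offline_opt Rv A th bb T - alg_reward Rv A sel kappa W th bb T
    <= T%:R * (2 * \sum_i `|Rv i|).
Proof.
have Rle i : `|Rv i| <= \sum_i `|Rv i| by rewrite (bigD1 i)//= lerDl sumr_ge0.
have bnd (z : bool) i : `|Rv i * z%:R| <= \sum_i `|Rv i|.
  rewrite normrM normr_nat; apply: le_trans (Rle i).
  by rewrite ler_piMr// lern1 leq_b1.
rewrite mulrCA mulr_natl mulr2n; apply: lerD.
- apply: bigmax_le => [|xf _]; first by rewrite mulr_ge0 ?sumr_ge0.
  rewrite mulr_natl -[X in _ *+ X]card_ord -sumr_const; apply: ler_sum => l _.
  exact: (le_trans (ler_norm _)).
- rewrite lerNl; apply: (@le_trans _ _ (\sum_(1 <= t < T.+1) - \sum_i `|Rv i|)).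
    by rewrite sumr_const_nat subn1/= mulNrn mulr_natl.
  by apply: ler_sum => t _; rewrite lerNl; apply: le_trans (bnd (x t) (th t)); rewrite -normrN ler_norm.
Qed.
End AnyRun.

(** * Runs with concentrated windows *)

Section GoodRun.
Context {R : realType} {n m : nat} (Rv : 'I_n -> R) (A : 'I_m -> 'I_n -> R).
Context (sel : ('I_m -> R) -> ('I_n -> R) -> @lpsol R n m) (kappa W : nat).
Context (th : nat -> 'I_n) (bb : nat -> 'I_m -> R) (T : nat).
Context (IV : {set 'I_n}) (y : 'I_m -> R) (v : 'I_n -> R) (beta M : R) (bup : 'I_m -> R).

Local Notation st k := (alg_state A sel kappa W th bb k).
Local Notation x t := (alg_x A sel kappa W th bb t).
Local Notation acc := (accepted A sel kappa W th bb).
Local Notation cnt := (@arrived R n th).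
Local Notation sup := (supplied bb).
Local Notation sol w := (sel (alg_Bhat kappa bb (w * kappa)) (alg_muhat kappa th (w * kappa))).
Local Notation quota w i := ((sol w).1.1 i).
(* When W = 0 nothing is accepted during the first block either, all quotas being 0. *)
Let Wp := maxn W 1.
(** A quota is indexed by the block [w] whose data it uses and is granted at the end of that block,
    so [U z.+1] is what has been granted when block [z.+1] starts. *)
Let U z i : R := \sum_(Wp <= w < z) quota w i.
Let N w i : R := cnt (w * kappa)%N i - cnt (w.-1 * kappa)%N i.

Hypothesis bb_ge0 : forall t j, 0 <= bb t j.
Hypothesis kappa_gt0 : (0 < kappa)%N.
Hypothesis dyv : dual_feasible Rv A y v.
Hypothesis X_ge0 : forall w i, (0 < w)%N -> (w * kappa <= T)%N -> 0 <= quota w i.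
Hypothesis X_le : forall w i, (0 < w)%N -> (w * kappa <= T)%N -> quota w i <= N w i.
Hypothesis X_eq : forall w i, (0 < w)%N -> (w * kappa <= T)%N -> i \notin IV -> quota w i = N w i.
Hypothesis X_next : forall w i, (0 < w)%N -> (w.+1 * kappa <= T)%N -> i \in IV ->
  quota w i <= N w.+1 i.
Hypothesis AX_le : forall w j, (0 < w)%N -> (w * kappa <= T)%N ->
  \sum_i A j i * quota w i <= sup (w * kappa)%N j - sup (w.-1 * kappa)%N j.
Hypothesis V_eq0 : forall w i, (0 < w)%N -> (w * kappa <= T)%N ->
  ((sol w).1.2 i == 0) = (i \notin IV).
Hypothesis obj_eq : forall w, (0 < w)%N -> (w * kappa <= T)%N ->
  \sum_i Rv i * quota w i = \sum_i v i * N w i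
     + \sum_j y j * (sup (w * kappa)%N j - sup (w.-1 * kappa)%N j).
Hypothesis sup_lb : forall w j, (0 < w)%N -> (w * kappa <= T)%N ->
  kappa%:R * beta <= sup (w * kappa)%N j - sup (w.-1 * kappa)%N j.
Hypothesis sup_ub : forall s j, (s + kappa <= T)%N ->
  sup (s + kappa)%N j - sup s j <= kappa%:R * bup j.
Hypothesis A_le : forall j i, `|A j i| <= M.
Hypothesis warmup : 3 * n%:R * M <= W%:R * beta.
Hypothesis beta_ge0 : 0 <= beta.
Hypothesis bup_ge0 : forall j, 0 <= bup j.

Lemma Wp_gt0 : (0 < Wp)%N. Proof. by rewrite leq_max orbT. Qed.

Lemma cnt_le i s k : (s <= k)%N -> cnt s i <= cnt k i.
Proof. exact: csum_le. Qed.

Lemma cnt_dist i s k : (s <= k)%N -> cnt k i - cnt s i <= (k - s)%:R.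
Proof. by apply: csum_le_dist => t; rewrite lern1 leq_b1. Qed.

Lemma sup_le j s k : (s <= k)%N -> sup s j <= sup k j.
Proof. by apply: csum_le => t; exact: bb_ge0. Qed.

Lemma accS k i : acc k.+1 i = acc k i + (x k.+1 && (th k.+1 == i))%:R.
Proof. exact: csumS. Qed.

Lemma cntS k i : cnt k.+1 i = cnt k i + (th k.+1 == i)%:R.
Proof. exact: csumS. Qed.

Lemma US z i : (Wp <= z)%N -> U z.+1 i = U z i + quota z i.
Proof. exact: big_nat_recr. Qed.

(** Before the first solve, at the end of period [Wp * kappa], all budgets are 0 and no type is
    accepted freely. The strict bound on [k] excludes the state that follows that solve. *)
Lemma warm_state k : (k < Wp * kappa)%N ->
  [/\ forall i, (st k).1.1 i = 0, (st k).2 = finset.set0 & forall i, acc k i = 0].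
Proof.
elim: k => [_|k IH kW]; first by split=> // i; exact: csum0.
have [Phi0 Ih0 acc0] := IH (ltnW kW).
have xk : x k.+1 = false.
  rewrite alg_xS Phi0 Ih0 inE lt_geF ?ltr01//= andbF !andbF.
  by [].
have nosolve : (W * kappa <= k.+1)%N && (kappa %| k.+1)%N = false.
  apply/negbTE/negP => /andP[WK /dvdnP[q qk]]; move: kW WK; rewrite /Wp qk.
  rewrite ltn_pmul2r// leq_pmul2r//.
  case: q qk => [|q _]; first by rewrite mul0n.
  by move=> h1 h2; lia.
split=> [i||i].
- by rewrite stateS_Phi nosolve xk !andbF Phi0 subr0 addr0.
- by rewrite stateS_Ih nosolve.
- by rewrite accS xk acc0 addr0.
Qed.

Lemma solveE k : (Wp * kappa <= k.+1)%N ->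
  (W * kappa <= k.+1)%N && (kappa %| k.+1)%N = (kappa %| k.+1)%N.
Proof.
move=> Wk; have -> : (W * kappa <= k.+1)%N by apply: leq_trans Wk; rewrite leq_mul2r leq_maxl orbT.
by [].
Qed.

Lemma run_state k : (Wp * kappa <= k <= T)%N ->
  (st k).2 = (~: IV)%SET /\
  forall i, i \in IV -> (st k).1.1 i = U (k %/ kappa).+1 i - acc k i.
Proof.
elim: k => [|k IH]; first by rewrite leqn0 muln_eq0 !gtn_eqF ?Wp_gt0.
move=> /andP[Wk kT].
have IhS : (st k.+1).2 = (~: IV)%SET.
  rewrite stateS_Ih solveE//; case: ifPn => [kk|nk].
    have q0 : (0 < k.+1 %/ kappa)%N by rewrite divn_gt0// dvdn_leq.
    by apply/setP => i; rewrite !inE -{1 2}(divnK kk) V_eq0// divnK.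
  have Wk' : (Wp * kappa <= k)%N.
    move: Wk; rewrite leq_eqVlt ltnS => /orP[/eqP Wk|//].
    by rewrite -Wk dvdn_mull in nk.
  by rewrite (IH _).1// Wk' ltnW.
split=> // i iIV; rewrite stateS_Phi solveE// accS.
have [q [r [rk kE]]] : exists q r, (r < kappa)%N /\ k = (q * kappa + r)%N.
  by exists (k %/ kappa)%N, (k %% kappa)%N; rewrite ltn_mod -divn_eq.
have kq : (k %/ kappa)%N = q by rewrite kE divnMDl// divn_small// addn0.
(* The case [q < Wp] arises only for [k.+1 = Wp * kappa], when the state at [k] is still the warm
   one. *)
have Phik : (st k).1.1 i - [&& i == th k.+1, th k.+1 \notin (st k).2 & x k.+1]%:R =
    (if (Wp <= q)%N then U q.+1 i else 0) - (acc k i + (x k.+1 && (th k.+1 == i))%:R).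
  have [Wk'|kW'] := leqP (Wp * kappa) k.
    have [] := IH _; first by rewrite Wk' ltnW.
    move=> Ihk -> //; rewrite Ihk kq.
    have -> : (Wp <= q)%N by rewrite -kq leq_divRL.
    rewrite !inE negbK opprD addrA; congr (_ - _%:R).
    by rewrite eq_sym; case: eqP => [->|]; rewrite ?andbF// iIV andbT.
  have [Phi0 Ih0 acc0] := warm_state _ kW'.
  have -> : (Wp <= q)%N = false by rewrite -kq leq_divRL// leqNgt kW'.
  rewrite Phi0 Ih0 acc0 inE !add0r; congr (- _%:R).
  by rewrite eq_sym andbC.
rewrite Phik; case: (boolP (kappa %| k.+1)%N) => [kk|nk].
  have rE : r.+1 = kappa.
    apply/eqP; rewrite eqn_leq rk /=; move: kk.
    rewrite kE -addnS dvdn_addr ?dvdn_mull// => /dvdn_leq; exact.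
  have k1E : k.+1 = (q.+1 * kappa)%N by rewrite kE -addnS rE mulSn addnC.
  have Wq : (Wp <= q.+1)%N by move: Wk; rewrite k1E leq_pmul2r.
  have -> : (k.+1 %/ kappa)%N = q.+1 by rewrite k1E mulnK.
  rewrite (US q.+1)//.
  have -> : (if (Wp <= q)%N then U q.+1 i else 0) = U q.+1 i.
    by case: leqP => // qW; rewrite /U big_geq.
  by rewrite -k1E; ring.
have k1q : (k.+1 %/ kappa)%N = q.
  have : (r.+1 < kappa)%N.
    rewrite ltn_neqAle rk andbT; apply: contra nk => /eqP rE.
    by rewrite kE -addnS rE dvdn_addr// dvdn_mull.
  by move=> r1; rewrite kE -addnS divnMDl// divn_small// addn0.
have -> : (Wp <= q)%N by rewrite -k1q leq_divRL.
by rewrite k1q addr0.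
Qed.

(* The accumulated quota not yet used is below 1 as soon as the arrivals of the block exceed
   the quota added at its start. *)
Definition quota_inv z k : Prop :=
  (forall i, i \in IV -> 0 <= U z.+1 i - acc k i <
      1 + Num.max 0 (quota z i - (cnt k i - cnt (z * kappa)%N i))) /\
  (forall i, i \notin IV -> acc k i = cnt k i - cnt (Wp * kappa)%N i).

Lemma sum_telescope (F : nat -> R) z : (Wp <= z)%N ->
  \sum_(Wp <= w < z) (F w - F w.-1) = F z.-1 - F Wp.-1.
Proof.
move=> Wz; have Wp0 := Wp_gt0.
rewrite -[z]prednK ?(leq_trans Wp0)// -[X in \sum_(X <= _ < _) _]prednK//.
by rewrite big_add1/= telescope_sumr//; lia.
Qed.

(** For a type in [IV], the invariant keeps [acc] between [U z - 1] and [U z + quota z]. For the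
    others both quantities count arrivals, [U z] lagging one block behind at each end: the surplus
    is at most [2 * kappa], the deficit at most [kappa]. *)
Lemma deviation_le z k i : (Wp <= z)%N -> (z * kappa <= k <= z.+1 * kappa)%N -> (k <= T)%N ->
  quota_inv z k -> `|acc k i - U z i| <= 2 * kappa%:R.
Proof.
move=> Wz /andP[zk kz] kT [invV invI].
have z0 : (0 < z)%N by apply: leq_trans Wz; exact: Wp_gt0.
have zT : (z * kappa <= T)%N by exact: leq_trans kT.
have k1 : 1 <= kappa%:R :> R by rewrite ler1n.
have Nle w : (0 < w)%N -> N w i <= kappa%:R.
  move=> w0; rewrite /N; have w1 : (w.-1 * kappa <= w * kappa)%N by rewrite leq_mul2r leq_pred orbT.
  apply: le_trans (cnt_dist i _ _ w1) _.
  have w2 : (w - w.-1 = 1)%N by lia.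
  by rewrite ler_nat -mulnBl w2 mul1n.
have [iIV|iIV] := boolP (i \in IV).
  have /andP[] := invV i iIV; rewrite US//.
  have cz := cnt_le i _ _ zk.
  have Xz0 := X_ge0 _ i z0 zT; have Xzl := X_le _ i z0 zT; have Nz := Nle z z0.
  rewrite ler_norml => h1 h2; have h3 : U z i + quota z i - acc k i < 1 + quota z i.
    by apply: lt_le_trans h2 _; rewrite lerD2l ge_max Xz0/=; lra.
  by apply/andP; split; lra.
rewrite invI//.
have -> : U z i = cnt (z.-1 * kappa)%N i - cnt (Wp.-1 * kappa)%N i.
  rewrite -(sum_telescope (fun w => arrived th (w * kappa) i))//.
  apply: eq_big_nat => w /andP[Ww wz]; apply: X_eq => //.
    by apply: leq_trans Ww; exact: Wp_gt0.
  by apply: leq_trans zT; rewrite leq_mul2r ltnW ?orbT.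
have c1 := Nle _ z0; have c2 := Nle _ Wp_gt0; rewrite /N in c1 c2.
have c3 := cnt_le i _ _ zk.
have c4 : cnt k i - cnt (z * kappa)%N i <= kappa%:R.
  apply: le_trans (cnt_dist _ _ _ zk) _; rewrite ler_nat.
  by rewrite leq_subLR -mulSnr.
have c5 : cnt (z.-1 * kappa)%N i <= cnt (z * kappa)%N i.
  by apply: cnt_le; rewrite leq_mul2r leq_pred orbT.
have c6 : cnt (Wp.-1 * kappa)%N i <= cnt (Wp * kappa)%N i.
  by apply: cnt_le; rewrite leq_mul2r leq_pred orbT.
by rewrite ler_norml; apply/andP; split; lra.
Qed.

(** The quotas in [U z] consume at most the supply of blocks [Wp] to [z - 1]. The first [Wp - 1]
    blocks and block [z] remain, worth at least [Wp * kappa * beta >= 3 * n * M * kappa]: two thirds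
    absorb the deviation, the last third covers one order. *)
Lemma inventory_ok z k j i : (Wp <= z)%N -> (z * kappa <= k <= z.+1 * kappa)%N -> (k <= T)%N ->
  quota_inv z k -> A j i <= (st k).1.2 j.
Proof.
move=> Wz zk kT inv; rewrite inventoryE.
have z0 : (0 < z)%N by apply: leq_trans Wz; exact: Wp_gt0.
have zT : (z * kappa <= T)%N by case/andP: zk => zk _; exact: leq_trans kT.
have M0 : 0 <= M by apply: le_trans (A_le j i).
have -> : \sum_i0 A j i0 * acc k i0 =
    \sum_i0 A j i0 * U z i0 + \sum_i0 A j i0 * (acc k i0 - U z i0).
  by rewrite -big_split/=; apply: eq_bigr => i0 _; rewrite -mulrDr addrC subrK.
have dev : \sum_i0 A j i0 * (acc k i0 - U z i0) <= n%:R * (M * (2 * kappa%:R)).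
  rewrite mulr_natl -[X in _ *+ X]card_ord -sumr_const; apply: ler_sum => i0 _.
  apply: le_trans (ler_norm _) _; rewrite normrM; apply: ler_pM => //.
  exact: deviation_le.
have AU : \sum_i0 A j i0 * U z i0 <= sup (z.-1 * kappa)%N j - sup (Wp.-1 * kappa)%N j.
  rewrite -(sum_telescope (fun w => supplied bb (w * kappa) j))// /U.
  under eq_bigr do rewrite mulr_sumr.
  rewrite exchange_big/=; apply: ler_sum_nat => w /andP[Ww wz]; apply: AX_le.
    by apply: leq_trans Ww; exact: Wp_gt0.
  by apply: leq_trans zT; rewrite leq_mul2r ltnW ?orbT.
have supz := sup_lb _ j z0 zT.
have supk : sup (z * kappa)%N j <= sup k j by apply: sup_le; case/andP: zk.
have supW w : (w * kappa <= T)%N -> w%:R * (kappa%:R * beta) <= sup (w * kappa)%N j.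
  elim: w => [|w IH] wT; first by rewrite mul0r; exact: sumr_ge0.
  have := sup_lb _ j (ltn0Sn w) wT; rewrite /= -addn1 natrD mulrDl mul1r addn1.
  have := IH (leq_trans _ wT); rewrite leq_mul2r leqnSn orbT => /(_ isT); lra.
have := supW Wp.-1; rewrite (leq_trans _ zT) ?leq_mul2r ?(leq_trans (leq_pred _) Wz) ?orbT//.
move=> /(_ isT) supWp.
have Wle : W%:R * (kappa%:R * beta) <= Wp.-1%:R * (kappa%:R * beta) + kappa%:R * beta.
  have -> : Wp.-1%:R * (kappa%:R * beta) + kappa%:R * beta = Wp%:R * (kappa%:R * beta) :> R.
    by rewrite -{2}[Wp]prednK ?Wp_gt0// -addn1 natrD; ring.
  by apply: ler_wpM2r; [exact: mulr_ge0|rewrite ler_nat leq_maxl].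
have wk : kappa%:R * (3 * n%:R * M) <= kappa%:R * (W%:R * beta) by apply: ler_wpM2l.
have n1 : 1 <= n%:R :> R by rewrite ler1n (leq_ltn_trans _ (ltn_ord i)).
have k1 : 1 <= kappa%:R :> R by rewrite ler1n.
have Mle : M <= n%:R * kappa%:R * M.
  by apply: ler_peMl => //; rewrite -natrM ler1n muln_gt0 kappa_gt0 andbT -(ler1n R).
have Aji : A j i <= M by apply: le_trans (A_le j i); exact: ler_norm.
have e1 : kappa%:R * (3 * n%:R * M) = n%:R * (M * (2 * kappa%:R)) + n%:R * kappa%:R * M by ring.
have e2 : kappa%:R * (W%:R * beta) = W%:R * (kappa%:R * beta) by ring.
lra.
Qed.

Lemma quota_inv_step z k : (Wp <= z)%N -> (z * kappa <= k < z.+1 * kappa)%N -> (k < T)%N ->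
  quota_inv z k -> quota_inv z k.+1.
Proof.
move=> Wz /andP[zk kz] kT inv.
have kW : (Wp * kappa <= k)%N by apply: leq_trans zk; rewrite leq_mul2r Wz orbT.
have [] := run_state k; first by rewrite kW ltnW.
have -> : (k %/ kappa)%N = z.
  by apply/eqP; rewrite eqn_leq -ltnS ltn_divLR// kz leq_divRL.
move=> Ihk Phik.
have ok : [forall j, A j (th k.+1) <= (st k).1.2 j].
  apply/forallP => j; apply: (inventory_ok z) => //; last exact: ltnW.
  by rewrite zk ltnW.
have xk : x k.+1 = (th k.+1 \notin IV) || (1 <= (st k).1.1 (th k.+1)).
  rewrite alg_xS ok Ihk inE.
  by rewrite ltnS (leq_trans _ kW)// leq_mul2r leq_maxl orbT.
case: inv => invV invI; split=> i iIV; rewrite accS cntS.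
- have := invV i iIV; set D := cnt k i - cnt (z * kappa)%N i.
  rewrite addrAC -/D; have [thi|_] := eqVneq (th k.+1) i; last first.
    by rewrite andbF !addr0.
  rewrite xk thi iIV/= Phik// andbT.
  case: (leP 1 (U z.+1 i - acc k i)) => [Phi1|Phi1] /andP[h1 h2]; last rewrite addr0 h1/=.
    rewrite /= mulr1n; apply/andP; split; first lra.
    move: h2; rewrite -ltrBlDl lt_max => /orP[|] h2; first lra.
    apply: (@lt_le_trans _ _ (1 + (quota z i - (D + 1)))); first lra.
    by rewrite lerD2l le_max lexx orbT.
  by rewrite (lt_le_trans Phi1)// lerDl le_max lexx.
- rewrite invI//; have [thi|_] := eqVneq (th k.+1) i; last by rewrite andbF !addr0.
  by rewrite xk thi iIV/= addrAC.
Qed.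

(** Within a block this is [quota_inv_step]. At a block boundary [X_next] makes the maximum vanish,
    so less than 1 is left over when the new quota is added and the arrival count restarts at 0. *)
Lemma run_inv k : (Wp * kappa <= k <= T)%N -> quota_inv (k %/ kappa) k.
Proof.
elim: k => [|k IH]; first by rewrite leqn0 muln_eq0 !gtn_eqF ?Wp_gt0.
move=> /andP[Wk kT].
have [Wk'|kW'] := leqP (Wp * kappa) k; last first.
  have kE : k.+1 = (Wp * kappa)%N by apply/eqP; rewrite eqn_leq Wk kW'.
  have WpT : (Wp * kappa <= T)%N by rewrite -kE.
  have [_ _ acc0] := warm_state _ kW'.
  have xk : x k.+1 = false.
    have [Phi0 Ih0 _] := warm_state _ kW'.
    by rewrite alg_xS Phi0 Ih0 inE lt_geF ?ltr01//= !andbF.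
  have acc1 i : acc k.+1 i = 0 by rewrite accS xk acc0 addr0.
  have -> : (k.+1 %/ kappa)%N = Wp by rewrite kE mulnK.
  split=> i iIV; rewrite acc1; last by rewrite -kE subrr.
  have X0 := X_ge0 _ i Wp_gt0 WpT.
  rewrite US// /U big_geq// add0r subr0 X0 kE subrr subr0.
  by rewrite maxEle X0; lra.
have inv := IH; move: inv; rewrite Wk' ltnW// => /(_ isT) inv.
set z := (k %/ kappa)%N in inv.
have Wz : (Wp <= z)%N by rewrite leq_divRL.
have zk : (z * kappa <= k < z.+1 * kappa)%N by rewrite leq_trunc_div -ltn_divLR// ltnSn.
have inv' := quota_inv_step z k Wz zk kT inv.
have [nk|kk] := boolP (k.+1 == z.+1 * kappa)%N; last first.
  suff -> : (k.+1 %/ kappa)%N = z by [].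
  apply/eqP; rewrite eqn_leq -ltnS ltn_divLR// leq_divRL//.
  case/andP: zk => zk1 zk2; rewrite ltn_neqAle kk zk2/=.
  exact: leqW.
rewrite (eqP nk) mulnK//; rewrite (eqP nk) in inv' kT; case: inv' => invV invI.
have zz0 : (0 < z)%N by apply: leq_trans Wz; exact: Wp_gt0.
split=> // i iIV; have := invV i iIV.
have Xn := X_next _ i zz0 kT iIV; rewrite /N/= in Xn.
have X0 := X_ge0 _ i (ltn0Sn z) kT.
rewrite (US z.+1) ?(leqW Wz)// subrr subr0.
have -> : Num.max 0 (quota z i - (cnt (z.+1 * kappa)%N i - cnt (z * kappa)%N i)) = 0.
  by apply/max_idPl; rewrite subr_le0.
have -> : Num.max 0 (quota z.+1 i) = quota z.+1 i by apply/max_idPr.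
by move=> /andP[? ?]; apply/andP; split; lra.
Qed.

(** The quotas earn the dual value of blocks [Wp] to [K - 1], and the offline bound is the same
    functional on all of the horizon. The difference is the price of the missing periods plus the
    tracking error. *)
Lemma good_run_regret :
  offline_opt Rv A th bb T - alg_reward Rv A sel kappa W th bb T <=
  kappa%:R * (Wp.+1%:R * (2 * \sum_i `|Rv i| + \sum_i v i + \sum_j y j * bup j)).
Proof.
have [y0 v0 _] := dyv.
have kT0 : 0 <= kappa%:R :> R by [].
have S0 : 0 <= \sum_i `|Rv i| by exact: sumr_ge0.
have v0S : 0 <= \sum_i v i by exact: sumr_ge0.
have yS0 : 0 <= \sum_j y j * bup j by apply: sumr_ge0 => j _; exact: mulr_ge0.
have [TW|WT] := ltnP T (Wp * kappa).
  apply: le_trans (regret_trivial_bound _ _ _ _ _ _ _ _) _; rewrite [X in _ <= X]mulrA; apply: ler_pM => //.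
  - by rewrite mulr_ge0.
  - by rewrite -natrM ler_nat mulnC ltnW// (leq_trans TW)// leq_mul2r leqnSn orbT.
  - by lra.
have TWT : (Wp * kappa <= T <= T)%N by rewrite WT leqnn.
have inv := run_inv T TWT; set K := (T %/ kappa)%N in inv.
have WK : (Wp <= K)%N by rewrite leq_divRL.
have K0 : (0 < K)%N by apply: leq_trans WK; exact: Wp_gt0.
have KT : (K * kappa <= T)%N by exact: leq_trunc_div.
have TK : (T < K.+1 * kappa)%N by rewrite -ltn_divLR.
have kleT : (kappa <= T)%N by apply: leq_trans KT; exact: leq_pmull.
have dev i : `|acc T i - U K i| <= 2 * kappa%:R.
  by apply: deviation_le; rewrite ?KT ?(ltnW TK).
have rew : \sum_i Rv i * U K i - 2 * kappa%:R * \sum_i `|Rv i| <=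
    alg_reward Rv A sel kappa W th bb T.
  rewrite alg_rewardE -subr_ge0 opprB addrCA -sumrB mulr_sumr -big_split/=.
  apply: sumr_ge0 => i _; rewrite -mulrBr.
  have : `|Rv i * (acc T i - U K i)| <= 2 * kappa%:R * `|Rv i|.
    by rewrite normrM mulrC ler_wpM2r.
  by rewrite ler_norml => /andP[? ?]; lra.
have RU : \sum_i Rv i * U K i =
    \sum_i v i * (cnt (K.-1 * kappa)%N i - cnt (Wp.-1 * kappa)%N i)
    + \sum_j y j * (sup (K.-1 * kappa)%N j - sup (Wp.-1 * kappa)%N j).
  transitivity (\sum_(Wp <= w < K) \sum_i Rv i * quota w i).
    by rewrite exchange_big/=; apply: eq_bigr => i _; rewrite mulr_sumr.
  rewrite (eq_big_nat _ _ (F2 := fun w => \sum_i v i * N w i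
     + \sum_j y j * (sup (w * kappa)%N j - sup (w.-1 * kappa)%N j))); last first.
    move=> w /andP[Ww wK]; apply: obj_eq; first by apply: leq_trans Ww; exact: Wp_gt0.
    by apply: leq_trans KT; rewrite leq_mul2r ltnW ?orbT.
  rewrite big_split/= exchange_big/= [X in _ + X]exchange_big/=.
  congr (_ + _); apply: eq_bigr => i _; rewrite -mulr_sumr; congr (_ * _).
    exact: (sum_telescope (fun w => arrived th (w * kappa) i)).
  exact: (sum_telescope (fun w => supplied bb (w * kappa) i)).
have off := offline_opt_le_dual Rv A th bb bb_ge0 T y v dyv.
(* The missing periods: [Wp - 1] initial blocks, and fewer than [2 * kappa] periods after
   [K.-1 * kappa]. *)
have WpE : Wp.+1%:R = 2 + Wp.-1%:R :> R.
  by rewrite -{1}[Wp]prednK ?Wp_gt0// -natrD; congr (_%:R); lia.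
have cntb i : cnt T i - cnt (K.-1 * kappa)%N i + cnt (Wp.-1 * kappa)%N i <= kappa%:R * Wp.+1%:R.
  rewrite WpE mulrDr; apply: lerD.
    have KT' : (K.-1 * kappa <= T)%N by apply: leq_trans KT; rewrite leq_mul2r leq_pred orbT.
    apply: le_trans (cnt_dist _ _ _ KT') _; rewrite -natrM ler_nat leq_subLR.
    have -> : (K.-1 * kappa + kappa * 2 = K.+1 * kappa)%N by rewrite mulnC -mulnDr addn2 prednK// mulnC.
    exact: ltnW.
  have := cnt_dist i _ _ (leq0n (Wp.-1 * kappa)).
  by rewrite /cnt /arrived csum0 subr0 subn0 natrM mulrC.
have supb j : sup T j - sup (K.-1 * kappa)%N j + sup (Wp.-1 * kappa)%N j
    <= kappa%:R * Wp.+1%:R * bup j.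
  rewrite WpE mulrDr mulrDl; apply: lerD.
    (* The incomplete last block lies in the window of length [kappa] ending at [T], which need not
       be aligned with the blocks; this is why [sup_ub] ranges over all offsets. *)
    have h1 : sup T j - sup (K * kappa)%N j <= kappa%:R * bup j.
      have := sup_ub (T - kappa)%N j; rewrite subnK// => /(_ (leqnn _)).
      have : sup (T - kappa)%N j <= sup (K * kappa)%N j.
        by apply: sup_le; rewrite leq_subLR -mulSn ltnW.
      lra.
    have h2 : sup (K * kappa)%N j - sup (K.-1 * kappa)%N j <= kappa%:R * bup j.
      have := sup_ub (K.-1 * kappa)%N j.
      by rewrite addnC -mulSn prednK// => /(_ KT).
    have -> : kappa%:R * 2 * bup j = kappa%:R * bup j + kappa%:R * bup j by ring.
    lra.
  have : (Wp.-1 * kappa <= T)%N.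
    by apply: leq_trans WT; rewrite leq_mul2r leq_pred orbT.
  elim: Wp.-1 => [|w IH] wT; first by rewrite mulr0 mul0r mul0n /supplied csum0.
  have := IH (leq_trans _ wT); rewrite leq_mul2r leqnSn orbT => /(_ isT) IHw.
  have := sup_ub (w * kappa)%N j; rewrite addnC -mulSn => /(_ wT).
  have -> : kappa%:R * w.+1%:R * bup j = kappa%:R * w%:R * bup j + kappa%:R * bup j.
    by rewrite -addn1 natrD; ring.
  lra.
have vb : \sum_i v i * cnt T i - \sum_i v i * (cnt (K.-1 * kappa)%N i - cnt (Wp.-1 * kappa)%N i)
    <= kappa%:R * Wp.+1%:R * \sum_i v i.
  rewrite -sumrB mulr_sumr; apply: ler_sum => i _; rewrite -mulrBr mulrC ler_wpM2r//.
  by rewrite opprB addrA addrAC; exact: cntb.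
have yb : \sum_j y j * sup T j - \sum_j y j * (sup (K.-1 * kappa)%N j - sup (Wp.-1 * kappa)%N j)
    <= kappa%:R * Wp.+1%:R * \sum_j y j * bup j.
  rewrite -sumrB mulr_sumr; apply: ler_sum => j _; rewrite -mulrBr mulrCA ler_wpM2l//.
  by rewrite opprB addrA addrAC; exact: supb.
have Rb : 2 * kappa%:R * \sum_i `|Rv i| <= kappa%:R * Wp.+1%:R * (2 * \sum_i `|Rv i|).
  have -> : 2 * kappa%:R * \sum_i `|Rv i| = kappa%:R * (2 * \sum_i `|Rv i|) by ring.
  apply: ler_wpM2r; first by rewrite mulr_ge0.
  by rewrite ler_peMr// ler1n.
have -> : kappa%:R * (Wp.+1%:R * (2 * \sum_i `|Rv i| + \sum_i v i + \sum_j y j * bup j)) =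
  kappa%:R * Wp.+1%:R * (2 * \sum_i `|Rv i|) + kappa%:R * Wp.+1%:R * \sum_i v i +
  kappa%:R * Wp.+1%:R * \sum_j y j * bup j by rewrite !mulrDr !mulrA.
lra.
Qed.
End GoodRun.

(** * Iterated expectations and concentration *)

Section Expectation.
Context {R : realType} {d : measure_display} {Omega : measurableType d}.
Context (P : probability Omega R).

(* No measurability is assumed: [sel] is arbitrary, so the regret need not be a measurable
   function of the sample. *)
Lemma ge0_integral_mono (f g : Omega -> \bar R) :
  (forall w, 0 <= f w)%E -> (forall w, f w <= g w)%E ->
  (\int[P]_w f w <= \int[P]_w g w)%E.
Proof.
move=> f0 fg; have g0 w : (0 <= g w)%E by exact: le_trans (fg w).
rewrite !ge0_integralTE//; apply: le_ereal_sup => _ [h hf <-].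
by exists h => // w; exact: le_trans (hf w) (fg w).
Qed.

Lemma integral_pr_cst (c : R) : (\int[P]_w c%:E = c%:E)%E.
Proof.
have := integral_cst P measurableT c%:E.
by rewrite [X in (_ = _ * X)%E](_ : _ = 1%E) ?mule1//; exact: probability_setT.
Qed.

Lemma iid_expect_ge0 k (F : (nat -> Omega) -> R) :
  (forall w, 0 <= F w) -> (0 <= iid_expect P k F)%E.
Proof.
elim: k F => [|k IH] F F0 /=; first by rewrite lee_fin.
by apply: integral_ge0 => w _; apply: IH.
Qed.

Lemma iid_expect_mono k (F G : (nat -> Omega) -> R) :
  (forall w, 0 <= F w) -> (forall w, F w <= G w) ->
  (iid_expect P k F <= iid_expect P k G)%E.
Proof.
elim: k F G => [|k IH] F G F0 FG /=; first by rewrite lee_fin.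
apply: ge0_integral_mono => w; first exact: iid_expect_ge0.
exact: IH.
Qed.

(* Sums of products of one-coordinate functions are integrated exactly, without any
   measurability argument on the product space. *)
Lemma iid_expect_sum_prod {I : finType} (f : I -> nat -> Omega -> R) (e : I -> nat -> R) :
  (forall l i, measurable_fun setT (f l i)) -> (forall l i w, 0 <= f l i w) ->
  (forall l i, \int[P]_w (f l i w)%:E = (e l i)%:E)%E ->
  forall k (c : R) (a : I -> R), 0 <= c -> (forall l, 0 <= a l) ->
  iid_expect P k (fun g => c + \sum_l a l * \prod_(i < k) f l i (g i)) =
  (c + \sum_l a l * \prod_(i < k) e l i)%:E.
Proof.
move=> mf f0 fe; have e0 l i : 0 <= e l i.
  by rewrite -lee_fin -fe; apply: integral_ge0 => w _; rewrite lee_fin.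
(* The outermost integral fixes coordinate [k]; its factor moves into the coefficients, which are
   therefore general in the induction. *)
elim=> [|k IH] c a c0 a0 /=.
  by congr (_ + _)%:E; apply: eq_bigr => l _; rewrite !big_ord0.
under eq_integral => w _.
  have -> : (fun g : nat -> Omega => c + \sum_l a l *
      \prod_(i < k.+1) f l i (if (i : nat) == k then w else g i)) =
      (fun g => c + \sum_l (a l * f l k w) * \prod_(i < k) f l i (g i)).
    apply/funext => g; congr (_ + _); apply: eq_bigr => l _.
    rewrite big_ord_recr/= eqxx -mulrA; congr (_ * _); rewrite mulrC; congr (_ * _).
    by apply: eq_bigr => i _; rewrite ltn_eqF.
  rewrite IH//; last by move=> l; rewrite mulr_ge0.
  have -> : (c + \sum_l a l * f l k w * \prod_(i < k) e l i)%:E =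
     (c%:E + \sum_l (a l * \prod_(i < k) e l i)%:E * (f l k w)%:E)%E.
    rewrite EFinD -sumEFin; congr (_ + _)%E; apply: eq_bigr => l _.
    by rewrite -EFinM mulrAC.
  over.
have ae0 l : 0 <= a l * \prod_(i < k) e l i by rewrite mulr_ge0// prodr_ge0.
have mterm l : measurable_fun setT (fun w => ((a l * \prod_(i < k) e l i)%:E * (f l k w)%:E)%E).
  apply: emeasurable_funM; first exact: measurable_cst.
  exact/measurable_EFinP.
rewrite ge0_integralD//=; [|by move=> w _; apply: sume_ge0 => l _; rewrite mule_ge0// lee_fin
  |exact: emeasurable_sum].
rewrite integral_pr_cst ge0_integral_sum//; last first.
  by move=> l w _; rewrite mule_ge0// lee_fin.
rewrite EFinD -sumEFin; congr (_ + _)%E; apply: eq_bigr => l _.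
rewrite ge0_integralZl_EFin//; [|by move=> w _; rewrite lee_fin|exact/measurable_EFinP].
by rewrite fe -EFinM big_ord_recr/= mulrA.
Qed.

(** From [(1 - x / 2) ^+ 2 <= expR (- x)] it is enough that the quadratic times that square is at
    least 1; the excess has the sign of [1 - 3 * x + x ^+ 2], positive up to [1 / 4]. *)
Lemma expR_le_quadratic (x : R) : x <= 4^-1 -> expR x <= 1 + x + x ^+ 2.
Proof.
move=> x4; have hx : 1 - x / 2 <= expR (- (x / 2)) by exact: expR_ge1Dx.
have u0 : 0 < 1 - x / 2 by lra.
have q0 : 0 <= 1 + x + x ^+ 2 by nra.
have key : 1 <= (1 + x + x ^+ 2) * (1 - x / 2) ^+ 2.
  have -> : (1 + x + x ^+ 2) * (1 - x / 2) ^+ 2 =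
    1 + (x / 2) ^+ 2 * (1 - 3 * x + x ^+ 2) by field.
  by rewrite lerDl mulr_ge0 ?sqr_ge0//; nra.
have : (1 - x / 2) ^+ 2 <= expR (- x).
  have -> : expR (- x) = expR (- (x / 2)) ^+ 2.
    by rewrite -expRM_natl; congr expR; field.
  by rewrite ler_pXn2r// nnegrE ?expR_ge0// ltW.
move=> /(ler_wpM2l q0)/(le_trans key).
by rewrite expRN ler_pdivlMr ?expR_gt0// mul1r.
Qed.

(** The quadratic bound on the exponential is integrated: the linear term is centred and vanishes,
    leaving [1 + lam ^+ 2 * c ^+ 2]. The real witness [e] records that the integral is finite. *)
Lemma mgf_le (Y : Omega -> R) (c lam : R) :
  measurable_fun setT Y -> (forall w, 0 <= Y w) -> P [set w | Y w < c] = 1%E ->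
  0 <= c -> `|lam| * c <= 4^-1 ->
  exists2 e : R,
    (\int[P]_w (expR (lam * (Y w - fine (\int[P]_w (Y w)%:E)%E))%R)%:E = e%:E)%E &
    e <= expR (lam ^+ 2 * c ^+ 2).
Proof.
move=> mY Y0 Yc c0 lc.
(* [Y] is below [c] only almost surely; truncation gives an everywhere bounded, hence integrable,
   version with the same integrals. *)
pose Z w := Num.min (Y w) c.
have mZ : measurable_fun setT Z by apply: measurable_minr => //; exact: measurable_cst.
have YZ : {ae P, forall w, Y w = Z w}.
  have mS : measurable [set w | Y w < c].
    rewrite -[X in measurable X]setTI; have := measurable_fun_ltr mY (measurable_cst c).
    by move=> /(_ measurableT [set true]); exact.
  exists (~` [set w | Y w < c]); split; first exact: measurableC.
    by rewrite probability_setC// Yc subee.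
  move=> w /=; apply: contra_not => /= Ycw; rewrite /Z.
  by apply/esym/min_idPl; exact: ltW.
have Z0 w : 0 <= Z w by rewrite le_min Y0.
have Zc w : Z w <= c by rewrite ge_min lexx orbT.
have iZ : P.-integrable setT (EFin \o Z).
  apply: measurable_bounded_integrable => //.
    by rewrite (le_lt_trans (probability_le1 _ _))// ltry.
  exists c; split; first exact: num_real.
  by move=> x cx w _; rewrite /= ger0_norm// (le_trans (Zc w))// ltW.
have -> : (\int[P]_w (Y w)%:E = \int[P]_w (Z w)%:E)%E.
  apply: ae_eq_integral => //; try exact/measurable_EFinP.
  by apply: filterS YZ => w /= ->.
have [mu ZE] : exists mu, (\int[P]_w (Z w)%:E = mu%:E)%E.
  by exists (fine (\int[P]_w (Z w)%:E)%E); rewrite fineK//; exact: integrable_fin_num.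
rewrite ZE /=.
have mu0 : 0 <= mu by rewrite -lee_fin -ZE; apply: integral_ge0 => w _; rewrite lee_fin.
have muc : mu <= c.
  rewrite -lee_fin -ZE -(integral_pr_cst c).
  by apply: ge0_integral_mono => w; rewrite lee_fin.
have mE (V : Omega -> R) : measurable_fun setT V ->
    measurable_fun setT (fun w => (expR (lam * (V w - mu)))%:E).
  move=> mV; apply/measurable_EFinP; apply: measurableT_comp => //.
  apply: measurable_funM; first exact: measurable_cst.
  by apply: measurable_funB => //; exact: measurable_cst.
have -> : (\int[P]_w (expR (lam * (Y w - mu)))%:E =
           \int[P]_w (expR (lam * (Z w - mu)))%:E)%E.
  apply: ae_eq_integral => //; try exact: mE.
  by apply: filterS YZ => w /= ->.
have le1 : (\int[P]_w (expR (lam * (Z w - mu)))%:E <= (expR (lam ^+ 2 * c ^+ 2))%:E)%E.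
  apply: (@le_trans _ _ (\int[P]_w
      ((EFin \o cst (1 - lam * mu + lam ^+ 2 * c ^+ 2)%R) \+ (EFin \o (fun w => lam * Z w)%R)) w)%E).
    apply: ge0_integral_mono => w; rewrite lee_fin ?expR_ge0//=.
    have Zmu : `|Z w - mu| <= c.
      by have := Z0 w; have := Zc w; rewrite ler_norml => ? ?; apply/andP; split; lra.
    have lZ : `|lam * (Z w - mu)| <= `|lam| * c by rewrite normrM ler_wpM2l.
    apply: le_trans (expR_le_quadratic _ _) _.
      by apply: le_trans (ler_norm _) _; exact: le_trans lc.
    have : (lam * (Z w - mu)) ^+ 2 <= lam ^+ 2 * c ^+ 2.
      rewrite -exprMn -real_normK ?num_real// -[leRHS]real_normK ?num_real//.
      by rewrite ler_pXn2r ?nnegrE// (le_trans lZ)// normrM (ger0_norm c0).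
    lra.
  have ilZ : P.-integrable setT (EFin \o (fun w => lam * Z w)%R).
    by rewrite (_ : _ \o _ = fun w => (lam%:E * (EFin \o Z) w)%E)//; exact: integrableZl.
  rewrite integralD_EFin//; last exact: finite_measure_integrable_cst.
  rewrite [X in (X + _)%E]integral_pr_cst.
  have -> : (\int[P]_w (EFin \o (fun w => lam * Z w)%R) w = (lam * mu)%:E)%E.
    by rewrite EFinM -ZE -integralZl.
  rewrite -EFinD lee_fin; apply: le_trans (expR_ge1Dx _); lra.
have ge0 : (0 <= \int[P]_w (expR (lam * (Z w - mu)))%:E)%E.
  by apply: integral_ge0 => w _; rewrite lee_fin expR_ge0.
case: (\int[P]_w _)%E le1 ge0 => [e|//|//].
by rewrite lee_fin => e1 _; exists e.
Qed.
End Expectation.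

(** * Deterministic regret bound from concentrated windows *)

Lemma le_maxabsA {R : realType} {n m : nat} (A : 'I_m -> 'I_n -> R) j i :
  `|A j i| <= maxabsA A.
Proof.
apply: le_trans (le_bigmax _ (fun j => \big[Num.max/0]_(i : 'I_n) `|A j i|) j).
exact: (le_bigmax _ (fun i => `|A j i|)).
Qed.

Lemma good_windows_regret {R : realType} {n m : nat} (Rv : 'I_n -> R)
    (A : 'I_m -> 'I_n -> R) (B : 'I_m -> R) (mu : 'I_n -> R) (L blow delta : R)
    (sel : ('I_m -> R) -> ('I_n -> R) -> @lpsol R n m) (W : nat) :
  lp_nondegenerate Rv A B mu ->
  (forall (Bh : 'I_m -> R) (muh : 'I_n -> R),
      (forall j, `|Bh j - B j| <= L) -> (forall i, `|muh i - mu i| <= L) ->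
      same_opt_basis Rv A B mu Bh muh) ->
  lp_selector Rv A sel ->
  0 <= delta -> 4 * delta <= L -> 4 * delta <= blow -> (forall j, blow < B j) ->
  4 * n%:R * maxabsA A <= W%:R * blow ->
  exists2 C0 : R, 0 <= C0 & forall kappa T (th : nat -> 'I_n) (bb : nat -> 'I_m -> R),
    (0 < kappa)%N -> (forall t j, 0 <= bb t j) ->
    (forall s, (s + kappa <= T)%N ->
      (forall j, `|supplied bb (s + kappa) j - supplied bb s j - kappa%:R * B j|
                   <= kappa%:R * delta) /\
      (forall i, `|arrived th (s + kappa) i - arrived th s i - kappa%:R * mu i|
                   <= kappa%:R * delta)) ->
    offline_opt Rv A th bb T - alg_reward Rv A sel kappa W th bb T <= kappa%:R * C0.
Proof.
move=> nondeg stable selP d0 dL db bB WA.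
have [y [v [IV [dyv sol_ok]]]] := stable_basis _ _ _ _ _ nondeg stable.
have [y0 v0 _] := dyv.
exists ((maxn W 1).+1%:R * (2 * \sum_i `|Rv i| + \sum_i v i + \sum_j y j * (B j + delta))).
  rewrite mulr_ge0// !addr_ge0 ?sumr_ge0//; last first.
    by move=> j _; rewrite mulr_ge0// addr_ge0// ltW// (le_lt_trans _ (bB j))//; lra.
  by rewrite mulr_ge0// sumr_ge0.
move=> kappa T th bb kappa0 bb0 good.
have k0 : 0 < kappa%:R :> R by rewrite ltr0n.
have BhatE w j : (0 < w)%N -> alg_Bhat kappa bb (w * kappa) j =
    supplied bb (w * kappa) j - supplied bb (w.-1 * kappa) j.
  case: w => // w _; rewrite /alg_Bhat mulSn addnC -addSn addnK.
  exact: (csum_window (fun t => bb t j)).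
have muhatE w i : (0 < w)%N -> @alg_muhat R n kappa th (w * kappa) i =
    arrived th (w * kappa) i - arrived th (w.-1 * kappa) i.
  case: w => // w _; rewrite /alg_muhat mulSn addnC -addSn addnK.
  exact: (csum_window (fun t => (th t == i)%:R)).
have goodw w : (0 < w)%N -> (w * kappa <= T)%N ->
    (forall j, `|supplied bb (w * kappa) j - supplied bb (w.-1 * kappa) j - kappa%:R * B j|
                   <= kappa%:R * delta) /\
    (forall i, `|arrived th (w * kappa) i - arrived th (w.-1 * kappa) i - kappa%:R * mu i|
                   <= kappa%:R * delta).
  by case: w => // w _ wT; have := good (w * kappa)%N; rewrite addnC -mulSn => /(_ wT).
pose sol w := sel (alg_Bhat kappa bb (w * kappa)) (alg_muhat kappa th (w * kappa)).
have optw w : lp_optimal Rv A (alg_Bhat kappa bb (w * kappa))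
    (alg_muhat kappa th (w * kappa)) (sol w).
  by apply: selP => k; apply: sumr_ge0.
have feasw w : (0 < w)%N ->
    [/\ forall j, \sum_i A j i * (sol w).1.1 i + (sol w).2 j =
          supplied bb (w * kappa) j - supplied bb (w.-1 * kappa) j,
        forall i, (sol w).1.1 i + (sol w).1.2 i =
          arrived th (w * kappa) i - arrived th (w.-1 * kappa) i,
        forall i, 0 <= (sol w).1.1 i, forall i, 0 <= (sol w).1.2 i &
        forall j, 0 <= (sol w).2 j].
  move=> w0; have := (optw w).1; case: (sol w) => [[X V] S] [e1 e2 X0 V0 S0].
  by split=> // k; rewrite ?e1 ?e2 ?BhatE ?muhatE.
have okw w : (0 < w)%N -> (w * kappa <= T)%N ->
  [/\ forall i, ((sol w).1.2 i == 0) = (i \notin IV),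
      forall i, i \in IV -> kappa%:R * (L - delta) < (sol w).1.2 i &
      \sum_i Rv i * (sol w).1.1 i =
        \sum_i v i * (arrived th (w * kappa) i - arrived th (w.-1 * kappa) i)
        + \sum_j y j * (supplied bb (w * kappa) j - supplied bb (w.-1 * kappa) j)].
  move=> w0 wT; have [gB gmu] := goodw w w0 wT.
  have [|||V0 VI obj] := sol_ok delta _ _ _ _ k0 _ _ _ (optw w).
  - lra.
  - by move=> j; rewrite BhatE.
  - by move=> i; rewrite muhatE.
  split=> //; rewrite -/(lp_obj Rv (sol w)) obj.
  by congr (_ + _); apply: eq_bigr => k _; rewrite ?BhatE ?muhatE.
(* A good window supplies at least [kappa * (B j - delta)], and [delta <= blow / 4], whence
   [beta = 3 / 4 * blow]; the warm-up condition is then [WA] multiplied by [3 / 4]. *)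
apply: (good_run_regret Rv A sel kappa W th bb T IV y v (3 / 4 * blow) (maxabsA A)) => //.
- by move=> w i w0 _; have [] := feasw w w0.
- by move=> w i w0 _; have [_ <- _ + _] := feasw w w0; rewrite lerDl; exact.
- move=> w i w0 wT iIV; have [/(_ i) + _ _] := okw w w0 wT; rewrite iIV => /eqP Vi.
  by have [_ <- _ _ _] := feasw w w0; rewrite Vi addr0.
(* The slack [V] exceeds [3 * kappa * delta], while the arrivals of two good blocks differ by at
   most [2 * kappa * delta]. *)
- move=> w i w0 wT iIV.
  have wT' : (w * kappa <= T)%N by apply: leq_trans wT; rewrite leq_mul2r leqnSn orbT.
  have [_ /(_ i iIV) Vi _] := okw w w0 wT'.
  have [_ /(_ i) XV _ _ _] := feasw w w0.
  have [_ /(_ i)] := goodw w w0 wT'.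
  have [_ /(_ i)] := goodw w.+1 (ltn0Sn w) wT.
  rewrite -XV !ler_norml => /andP[g1 _] /andP[_ g2].
  have h3 : kappa%:R * (3 * delta) <= kappa%:R * (L - delta) by rewrite ler_pM2l//; lra.
  suff : (sol w).1.1 i <= arrived th (w.+1 * kappa) i - arrived th (w * kappa) i by [].
  have kd0 : 0 <= kappa%:R * delta by rewrite mulr_ge0.
  by move: g1 => /= g1; lra.
- by move=> w j w0 _; have [<- _ _ _ +] := feasw w w0; rewrite lerDl; exact.
- by move=> w i w0 wT; have [] := okw w w0 wT.
- by move=> w w0 wT; have [] := okw w w0 wT.
- move=> w j w0 wT; have [/(_ j) + _] := goodw w w0 wT.
  rewrite ler_norml => /andP[g1 _]; have bBj := bB j.
  have : kappa%:R * (3 / 4 * blow) <= kappa%:R * (B j - delta) by rewrite ler_pM2l//; lra.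
  lra.
- move=> s j sT; have [/(_ j) + _] := good s sT.
  by rewrite ler_norml => /andP[_ g]; lra.
- by move=> j i; exact: le_maxabsA.
- lra.
- lra.
- by move=> j; have := bB j; lra.
Qed.

Lemma absz_ceil_bounds {R : realType} (x : R) : 0 <= x ->
  x <= (`|Num.ceil x|%N)%:R <= x + 1.
Proof.
move=> x0; have c0 : 0 <= Num.ceil x by rewrite ceil_ge0 (lt_le_trans _ x0)// ltrN10.
have -> : (`|Num.ceil x|%N)%:R = (Num.ceil x)%:~R :> R by rewrite natr_absz ger0_norm.
by rewrite ceil_ge/= -lerBlDr; have := ceilB1_lt x; rewrite intrB => /ltW.
Qed.

(** * Chernoff and union bounds over all windows *)

Section Concentration.
Context {R : realType} {d : measure_display} {Omega : measurableType d}.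
Context (P : probability Omega R).
Context {J : finType} (Y : J -> Omega -> R) (c delta : R).
Hypothesis mY : forall k, measurable_fun setT (Y k).
Hypothesis Y_ge0 : forall k w, 0 <= Y k w.
Hypothesis Y_lt : forall k, P [set w | Y k w < c] = 1%E.
Hypothesis c_gt0 : 0 < c.
Hypothesis delta_ge0 : 0 <= delta.
Hypothesis delta_le : 2 * delta <= c.

Let mean k := fine (\int[P]_w (Y k w)%:E)%E.

(** Exponential Markov and the union bound are made pointwise: each triple of quantity, sign and
    window start yields a product that is at least 1 on its bad event, so [F] lies below [u] plus
    [z] times the sum of these products. *)
Lemma iid_expect_windows (kappa T : nat) (F : (nat -> Omega) -> R) (u z : R) :
  (0 < kappa)%N -> 0 <= u -> 0 <= z ->
  (forall w, 0 <= F w) -> (forall w, F w <= z) ->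
  (forall w, (forall s k, (s + kappa <= T)%N ->
      `|\sum_(s <= t < s + kappa) Y k (w t) - kappa%:R * mean k| <= kappa%:R * delta) ->
    F w <= u) ->
  (iid_expect P T F <=
    (u + (2 * #|J| * T)%:R * (z * expR (- (kappa%:R * (delta ^+ 2 / (4 * c ^+ 2))))))%:E)%E.
Proof.
move=> kappa0 u0 z0 F0 Fz Fu.
have k0 : 0 <= kappa%:R :> R by [].
(* The minimiser of [lam ^+ 2 * c ^+ 2 - lam * delta], with value [- delta ^+ 2 / (4 * c ^+ 2)]. The
   condition [2 * delta <= c] yields [lam * c <= 1 / 4]. *)
pose lam := delta / (2 * c ^+ 2).
pose sg (b : bool) := if b then lam else - lam.
pose I : finType := (J * bool * 'I_T)%type.
(* The threshold [kappa * (lam * delta)] is split evenly among the coordinates of the window, so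
   that the whole bound factorises. *)
pose h (k : J) (b : bool) (w : Omega) : R := expR (sg b * (Y k w - mean k)) * expR (- (lam * delta)).
pose win (s t : nat) := (s <= t < s + kappa)%N.
pose f (l : I) (t : nat) (w : Omega) : R := if win l.2 t then h l.1.1 l.1.2 w else 1.
have lam0 : 0 <= lam by rewrite divr_ge0// mulr_ge0// sqr_ge0.
have sgabs b : `|sg b| = lam by case: b; rewrite /sg ?normrN ger0_norm.
have sg2 b : sg b ^+ 2 = lam ^+ 2 by case: b; rewrite /sg ?sqrrN.
have lamc : lam * c <= 4^-1.
  have -> : lam * c = delta / (2 * c) by rewrite /lam; field; rewrite gt_eqF.
  by rewrite ler_pdivrMr ?mulr_gt0//; have := delta_le; lra.
have mg k b : exists e, (\int[P]_w (h k b w)%:E = e%:E)%E /\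
    0 <= e <= expR (- (delta ^+ 2 / (4 * c ^+ 2))).
  have [|e he e1] := mgf_le P (Y k) c (sg b) (mY k) (Y_ge0 k) (Y_lt k) (ltW c_gt0).
    by rewrite sgabs.
  have e0 : 0 <= e.
    by rewrite -lee_fin -he; apply: integral_ge0 => w _; rewrite lee_fin expR_ge0.
  exists (e * expR (- (lam * delta))); split.
    under eq_integral do rewrite EFinM muleC.
    rewrite ge0_integralZl_EFin ?expR_ge0//.
      by rewrite he -EFinM mulrC.
    apply/measurable_EFinP; apply: measurableT_comp => //.
    apply: measurable_funM; first exact: measurable_cst.
    by apply: measurable_funB => //; exact: measurable_cst.
  rewrite mulr_ge0 ?expR_ge0//=.
  apply: le_trans (ler_wpM2r (expR_ge0 _) e1) _; rewrite -expRD ler_expR.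
  by rewrite sg2 le_eqVlt; apply/orP; left; apply/eqP; rewrite /lam; field; rewrite gt_eqF.
have /= [e he] := choice (fun kb : J * bool => mg kb.1 kb.2).
pose E (l : I) (t : nat) : R := if win l.2 t then e l.1 else 1.
(* Window starts are indexed by ['I_T] for convenience; those running past [T] get weight 0. *)
pose a (l : I) : R := if (l.2 + kappa <= T)%N then z else 0.
have a0 l : 0 <= a l by rewrite /a; case: ifP.
have mh k b : measurable_fun setT (h k b).
  apply: measurable_funM; last exact: measurable_cst.
  apply: measurableT_comp => //; apply: measurable_funM; first exact: measurable_cst.
  by apply: measurable_funB => //; exact: measurable_cst.
have h0 k b w : 0 <= h k b w by rewrite mulr_ge0 ?expR_ge0.
have f0 l t w : 0 <= f l t w by rewrite /f; case: ifP.
have prod_win (G : nat -> R) (s : nat) : (s + kappa <= T)%N ->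
    \prod_(t < T) (if win s t then G t else 1) = \prod_(s <= t < s + kappa) G t.
  move=> sT; rewrite -big_mkcond/= -(big_mkord (win s)).
  rewrite [RHS](big_nat_widen _ _ _ _ _ sT) [RHS](big_nat_widenl _ 0)//.
  by apply: eq_bigl => t; rewrite /win /= andbC.
apply: (@le_trans _ _ (iid_expect P T (fun g => u + \sum_l a l * \prod_(t < T) f l t (g t)))).
  apply: iid_expect_mono => // w.
  have sum0 : 0 <= \sum_l a l * \prod_(t < T) f l t (w t).
    by apply: sumr_ge0 => l _; rewrite mulr_ge0// prodr_ge0.
  have [allgood|] := pselect (forall s k, (s + kappa <= T)%N ->
      `|\sum_(s <= t < s + kappa) Y k (w t) - kappa%:R * mean k| <= kappa%:R * delta).
    by apply: (le_trans (Fu w allgood)); rewrite lerDl.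
  move=> /existsNP[s /existsNP[k /not_implyP[sT /negP]]].
  rewrite -ltNge => dev.
  have sltT : (s < T)%N by apply: leq_trans sT; rewrite -addn1 leq_add2l.
  have [b hb] : exists b, 1 <= \prod_(t < T) f (k, b, Ordinal sltT) t (w t).
    have prodE b : \prod_(t < T) f (k, b, Ordinal sltT) t (w t) =
        expR (sg b * (\sum_(s <= t < s + kappa) Y k (w t) - kappa%:R * mean k)
              - kappa%:R * (lam * delta)).
      rewrite (prod_win (fun t => h k b (w t)))//.
      under eq_bigr do rewrite /h -expRD.
      rewrite -expR_sum big_split/= -mulr_sumr sumrB !sumr_const_nat addKn.
      by rewrite !mulr_natl mulNrn.
    have [pos|neg] := leP 0 (\sum_(s <= t < s + kappa) Y k (w t) - kappa%:R * mean k).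
      exists true; rewrite prodE -[X in X <= _]expR0 ler_expR subr_ge0 mulrCA.
      by apply: ler_wpM2l => //; rewrite -(ger0_norm pos) ltW.
    exists false; rewrite prodE -[X in X <= _]expR0 ler_expR subr_ge0 mulrCA [leRHS]mulNr -mulrN.
    by apply: ler_wpM2l => //; rewrite -(ltr0_norm neg) ltW.
  apply: (le_trans (Fz w)); rewrite (bigD1 (k, b, Ordinal sltT))//=.
  have -> : a (k, b, Ordinal sltT) = z by rewrite /a /= sT.
  have zp : z <= z * \prod_(t < T) f (k, b, Ordinal sltT) t (w t) by rewrite ler_peMr.
  apply: (le_trans zp); rewrite addrCA lerDl addr_ge0// sumr_ge0// => l _.
  by rewrite mulr_ge0// prodr_ge0.
rewrite (iid_expect_sum_prod P f E)//; first last.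
- move=> l t; rewrite /f /E; case: ifP => _; first exact: (he l.1).1.
  by rewrite integral_pr_cst.
- by move=> l t; rewrite /f; case: (win l.2 t); [exact: mh|exact: measurable_cst].
rewrite lee_fin lerD2l.
have -> : (2 * #|J| * T)%:R = #|I|%:R :> R.
  by congr (_%:R); rewrite !card_prod card_bool card_ord [(2 * _)%N]mulnC.
rewrite mulr_natl -sumr_const; apply: ler_sum => l _; rewrite /a.
case: ifPn => lT; last by rewrite mul0r mulr_ge0 ?expR_ge0.
rewrite ler_wpM2l// (prod_win (fun=> e l.1))// prodr_const_nat addKn.
rewrite -mulrN expRM_natl; have [_ /andP[e0 e1]] := he l.1.
by apply: lerXn2r => //; rewrite nnegrE expR_ge0.
Qed.
End Concentration.

(** * Choice of constants and conclusion *)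

Lemma probability_lt_le {R : realType} {d : measure_display} {Omega : measurableType d}
    (P : probability Omega R) (f : Omega -> R) (c c' : R) :
  measurable_fun setT f -> c <= c' ->
  P [set w | f w < c] = 1%E -> P [set w | f w < c'] = 1%E.
Proof.
move=> mf cc' Pc; have mlt a : measurable [set w | f w < a].
  rewrite -[X in measurable X]setTI; have := measurable_fun_ltr mf (measurable_cst a).
  by move=> /(_ measurableT [set true]); exact.
apply/eqP; rewrite eq_le probability_le1//= -Pc.
by apply: le_measure; rewrite ?inE// => w /= /lt_le_trans; exact.
Qed.

Lemma indic_preimage_set1 {R : realType} {T : Type} {n : nat} (theta : T -> 'I_n) (i : 'I_n) :
  (fun w => (theta w == i)%:R) = \1_(theta @^-1` [set i]) :> (T -> R).
Proof.
apply/funext => w; rewrite indicE; suff -> : (theta w == i) = (w \in theta @^-1` [set i]) by [].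
by apply/eqP/idP; rewrite inE.
Qed.

Lemma type_probE {R : realType} {d : measure_display} {Omega : measurableType d} {n : nat}
    (P : probability Omega R) (theta : Omega -> 'I_n) (i : 'I_n) :
  measurable (theta @^-1` [set i]) ->
  fine (\int[P]_w ((theta w == i)%:R : R)%:E)%E = type_prob P theta i.
Proof.
move=> mi; rewrite /type_prob -[X in P X]setIT -integral_indic//; congr fine.
by rewrite -indic_preimage_set1.
Qed.

Lemma expR_neg_rate {R : realType} (a x t : R) : 0 < t -> 2 * ln t <= a * x ->
  expR (- (a * x)) <= (t ^+ 2)^-1.
Proof.
move=> t0 h; rewrite -(@lnK _ t) ?posrE// -expRM_natl -expRN ler_expR lerN2.
exact: h.
Qed.

Theorem theorem2 (R : realType) (d : measure_display) (Omega : measurableType d)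
  (P : probability Omega R) (n m : nat)
  (Rv : 'I_n -> R) (A : 'I_m -> 'I_n -> R)
  (theta : Omega -> 'I_n) (b : Omega -> 'I_m -> R)
  (mulow blow bbar L : R) :
  (forall i, measurable (theta @^-1` [set i])) ->
  (forall j, measurable_fun setT (fun w => b w j)) ->
  (forall w j, 0 <= b w j) ->
  0 < mulow -> 0 < blow -> 0 < bbar ->
  (forall i, mulow <= type_prob P theta i) ->
  (forall j, blow < mean_b P b j) ->
  (forall j, P [set w | b w j < bbar] = 1%E) ->
  lp_nondegenerate Rv A (mean_b P b) (type_prob P theta) ->
  0 < L ->
  (forall (Bh : 'I_m -> R) (muh : 'I_n -> R),
      (forall j, `|Bh j - mean_b P b j| <= L) ->
      (forall i, `|muh i - type_prob P theta i| <= L) ->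
      same_opt_basis Rv A (mean_b P b) (type_prob P theta) Bh muh) ->
  forall sel : ('I_m -> R) -> ('I_n -> R) -> lpsol,
  lp_selector Rv A sel ->
  exists (Cst : R) (T0 : nat), forall T : nat, (T0 <= T)%N ->
    (regret_alg2 P Rv A theta b mulow blow bbar L sel T <= (Cst * ln T%:R)%:E)%E.
Proof.
move=> mtheta mb b0 mulow0 blow0 bbar0 mulowP blowP bbarP nondeg L0 stable sel selP.
pose mn := Num.min L (Num.min blow mulow); pose delta := mn / 4.
have mn0 : 0 < mn by rewrite !lt_min L0 blow0.
have mnL : mn <= L by rewrite ge_min lexx.
have mnb : mn <= blow by rewrite !ge_min lexx orbT.
have mnm : mn <= mulow by rewrite !ge_min lexx !orbT.
(* Gives [mn <= 1], hence [2 * delta <= c]; the type of an arbitrary sample point serves as the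
   index. *)
have mulow1 : mulow <= 1.
  apply: (le_trans (mulowP (theta point))); rewrite /type_prob -lee_fin fineK ?probability_le1//.
  by rewrite fin_num_measure.
have delta0 : 0 < delta by rewrite divr_gt0.
(* A strict upper bound shared by the supplies and by the type indicators. *)
pose c := 1 + bbar; have c0 : 0 < c by rewrite addr_gt0.
pose Y (k : 'I_m + 'I_n) w : R :=
  match k with inl j => b w j | inr i => (theta w == i)%:R end.
have mY k : measurable_fun setT (Y k).
  case: k => [j|i]; first exact: mb.
  by rewrite [Y _]indic_preimage_set1; exact: measurable_indic.
have Y0 k w : 0 <= Y k w by case: k => [j|i] /=.
have Yc k : P [set w | Y k w < c] = 1%E.
  case: k => [j|i].
    by apply: probability_lt_le (bbarP j); [exact: mb|rewrite lerDr].
  rewrite (_ : [set w | _] = setT) ?probability_setT//; apply/seteqP; split=> // w _ /=.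
  by rewrite (@le_lt_trans _ _ 1)// ?lern1 ?leq_b1// ltrDl.
have maxA0 : 0 <= maxabsA A by exact: bigmax_ge_id.
have WA : 4 * n%:R * maxabsA A <= (alg_W A blow)%:R * blow.
  rewrite -ler_pdivrMr//.
  have /absz_ceil_bounds/andP[] : 0 <= 4 * n%:R * maxabsA A / blow.
    by rewrite divr_ge0 ?mulr_ge0// ltW.
  by [].
have d4 : 4 * delta = mn by rewrite /delta; field.
have [||C0 C00 good] := good_windows_regret Rv A _ _ L blow delta sel (alg_W A blow)
    nondeg stable selP (ltW delta0) _ _ blowP WA.
- by rewrite d4.
- by rewrite d4.
pose S := \sum_i `|Rv i|; have S0 : 0 <= S by exact: sumr_ge0.
pose C := alg_C mulow blow bbar L.
have CE : C = 2 * (1 + 8 * c / mn) ^+ 2 by rewrite /C /alg_C /c mulrDr mulr1.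
(* The exponent per period is [(mn / (8 * c)) ^+ 2], and [C] is twice the square of
   [1 + 8 * c / mn]; their product is [2 * (1 + mn / (8 * c)) ^+ 2]. The resulting 2 gives the
   failure rate [T^-2]. *)
have C_ge : 2 <= C * (delta ^+ 2 / (4 * c ^+ 2)).
  have -> : C * (delta ^+ 2 / (4 * c ^+ 2)) = 2 * ((1 + 8 * c / mn) * (mn / (8 * c))) ^+ 2.
    by rewrite CE /delta; field; rewrite !gt_eqF.
  rewrite ler_peMr//; apply: exprn_ege1.
  have -> : (1 + 8 * c / mn) * (mn / (8 * c)) = 1 + mn / (8 * c).
    by field; rewrite !gt_eqF.
  by rewrite lerDl divr_ge0 ?mulr_ge0// ltW.
have C_gt0 : 0 < C.
  rewrite CE mulr_gt0// exprn_gt0// addr_gt0// divr_gt0// mulr_gt0//.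
have ln2 : 0 < ln 2 :> R by rewrite ln_gt0// ltr1n.
(* From [T = 2] on, [1 <= ln T / ln 2] absorbs constants: the [+ 1] of the ceiling in [kappa], and
   the tail [2 * (m + n) * T] times [2 * T * S] times [T^-2]. *)
exists (C0 * (C + (ln 2)^-1) + 4 * (m + n)%:R * S / ln 2), 2%N => T T2.
have T0 : 0 < T%:R :> R by rewrite ltr0n ltnW.
have lnT : ln 2 <= ln T%:R :> R by rewrite ler_ln ?posrE// ler_nat.
have lnT0 : 0 < ln T%:R :> R by exact: lt_le_trans lnT.
set kappa := alg_kappa mulow blow bbar L T.
have /andP[kge kle] : C * ln T%:R <= kappa%:R <= C * ln T%:R + 1.
  by apply: absz_ceil_bounds; rewrite mulr_ge0// ltW.
have kappa0 : (0 < kappa)%N by rewrite -(ltr0n R) (lt_le_trans _ kge)// mulr_gt0.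
apply: le_trans (@iid_expect_windows _ _ _ P _ Y c delta mY Y0 Yc c0 (ltW delta0) _ kappa T _
  (kappa%:R * C0) (T%:R * (2 * S)) kappa0 _ _ _ _ _) _.
- by rewrite /delta /c; lra.
- by rewrite mulr_ge0.
- by rewrite !mulr_ge0.
- by move=> w; rewrite subr_ge0; apply: alg_reward_le_offline_opt.
- by move=> w; exact: regret_trivial_bound.
- move=> w wgood; apply: good => // s sT.
  (* Period [t] reads coordinate [t.-1], so periods [s + 1] to [s + kappa] are coordinates [s] to
     [s + kappa - 1]. *)
  have win (F : Omega -> R) : csum (fun t => F (w t.-1)) (s + kappa) - csum (fun t => F (w t.-1)) s
      = \sum_(s <= t < s + kappa) F (w t).
    by rewrite -csum_window big_add1.
  split=> k.
    by have := wgood s (inl k) sT; rewrite -(win (fun w => b w k)).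
  have := wgood s (inr k) sT.
  by rewrite -(win (fun w => (theta w == k)%:R)) type_probE.
rewrite lee_fin.
have rate : expR (- (kappa%:R * (delta ^+ 2 / (4 * c ^+ 2)))) <= (T%:R ^+ 2)^-1.
  apply: expR_neg_rate => //.
  have D0 : 0 <= delta ^+ 2 / (4 * c ^+ 2).
    by apply: divr_ge0; [exact: sqr_ge0|apply: mulr_ge0 => //; exact: sqr_ge0].
  apply: le_trans (ler_wpM2r D0 kge); rewrite mulrAC.
  by apply: ler_wpM2r => //; exact: ltW.
have tail : (2 * #|{: 'I_m + 'I_n}| * T)%:R *
    (T%:R * (2 * S) * expR (- (kappa%:R * (delta ^+ 2 / (4 * c ^+ 2))))) <= 4 * (m + n)%:R * S.
  apply: (@le_trans _ _ ((2 * #|{: 'I_m + 'I_n}| * T)%:R * (T%:R * (2 * S) * (T%:R ^+ 2)^-1))).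
    by apply: ler_wpM2l => //; apply: ler_wpM2l => //; rewrite !mulr_ge0.
  rewrite card_sum !card_ord !natrM le_eqVlt; apply/orP; left; apply/eqP.
  by field; rewrite gt_eqF.
apply: le_trans (lerD (ler_wpM2r C00 kle) tail) _.
have one : 1 <= (ln 2)^-1 * ln T%:R :> R by rewrite mulrC ler_pdivlMr// mul1r.
have e1 : C0 <= C0 * ((ln 2)^-1 * ln T%:R) by rewrite ler_peMr.
have e2 : 4 * (m + n)%:R * S <= 4 * (m + n)%:R * S * ((ln 2)^-1 * ln T%:R).
  by rewrite ler_peMr// !mulr_ge0.
have -> : (C0 * (C + (ln 2)^-1) + 4 * (m + n)%:R * S / ln 2) * ln T%:R =
    C * ln T%:R * C0 + C0 * ((ln 2)^-1 * ln T%:R) + 4 * (m + n)%:R * S * ((ln 2)^-1 * ln T%:R).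
  by ring.
rewrite mulrDl mul1r; lra.
Qed.
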